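(* Let $b$ be a nonzero complex number, $Q=b+b^{-1}$, let $Y_1,Y_2$ be partitions, and let $P\in\mathbb{C}$ be generic, in the sense that the number $$E:=E_{Y_1,Y_2}(P)=E_{Y_1}+E_{Y_2}+2P\,(|Y_1|-|Y_2|),\qquad E_Y=\sum_i\left(y_i^2\,b^{-1}+(2i-1)\,y_i\,b\right)\ \text{ for } Y=(y_1\ge y_2\ge\cdots),$$ is not an eigenvalue of $H_0$ on any of the subspaces $\mathcal{F}_{m,n}$ with $m+n=|Y_1|+|Y_2|$ and $m>|Y_1|$. Define $$R(E)\,J^+_{-Y_1}J^-_{-Y_2}|P\rangle:=\frac{1}{1-\frac{1}{E-H_0}H_I}\,J^+_{-Y_1}J^-_{-Y_2}|P\rangle:=\sum_{n=0}^{\infty}\left(\frac{1}{E-H_0}\,H_I\right)^{n}J^+_{-Y_1}J^-_{-Y_2}|P\rangle .$$ Then this vector is an eigenvector of $H=H_0+H_I$ with eigenvalue $E$: $$H\,R(E)\,J^+_{-Y_1}J^-_{-Y_2}|P\rangle=E_{Y_1,Y_2}(P)\,R(E)\,J^+_{-Y_1}J^-_{-Y_2}|P\rangle .$$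
   Context: Oscillators and Fock space. Let $a^{\pm}_n$ ($n\in\mathbb{Z}$) satisfy $[a^{\pm}_n,a^{\pm}_m]=n\,\delta_{n+m,0}$ and $[a^+_n,a^-_m]=0$. For $P\in\mathbb{C}$, let $\mathcal{F}$ be the Fock space generated from the vacuum $|P\rangle$, where $a^{\pm}_n|P\rangle=0$ for $n>0$ and $a^{\pm}_0|P\rangle=\pm iP|P\rangle$. Thus $\mathcal{F}$ is the polynomial algebra in the creation operators $a^{\pm}_{-n}$, $n>0$, applied to $|P\rangle$; for $n>0$, $a^{\pm}_n$ acts as $n\,\partial/\partial a^{\pm}_{-n}$, and $a^{\pm}_0$ acts as the scalar $\pm iP$. Write $\mathcal{F}=\bigoplus_{m,n\ge0}\mathcal{F}_{m,n}$, where $\mathcal{F}_{m,n}$ is the finite-dimensional span of monomials whose total degree in the $a^+_{-k}$ is $m$ and whose total degree in the $a^-_{-k}$ is $n$ (each $a^{\pm}_{-k}$ having degree $k$). Hamiltonian. Set $H=H_0+H_I$, $H_0=H^++H^-$, with $$H^{\pm}=-i\sum_{n,m\ge1}\left(a^{\pm}_{-n-m}a^{\pm}_na^{\pm}_m+a^{\pm}_{-n}a^{\pm}_{-m}a^{\pm}_{n+m}\right)+\sum_{n\ge1}\left(Qn-2i\,a^{\pm}_0\right)a^{\pm}_{-n}a^{\pm}_n-\frac{i}{3}(a^{\pm}_0)^3,$$ $$H_I=\sum_{n\ge1}2Qn\,a^+_{-n}a^-_n .$$ The operator $H_0$ preserves each $\mathcal{F}_{m,n}$, while $H_I$ maps $\mathcal{F}_{m,n}$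 into $\bigoplus_{k\ge1}\mathcal{F}_{m+k,n-k}$. Hence, in the series in the claim, $\frac{1}{E-H_0}$ is only applied to vectors in $\bigoplus_{m>|Y_1|,\,m+n=|Y_1|+|Y_2|}\mathcal{F}_{m,n}$, where it denotes the inverse of $E-H_0$, and the series has only finitely many nonzero terms. Jack states. For a partition $Y$, $|Y|$ denotes its size. Let $J_Y^{(\alpha)}$ be the integral-form Jack symmetric function with Jack parameter $\alpha=-1/b^2$, written as a polynomial in the power sums $p_n$; it is normalized so that the coefficient of $x_1x_2\cdots x_{|Y|}$ is $|Y|!$, and its coefficients are polynomial in $\alpha$, so it is defined for every $\alpha$ by specialization. Then $J^{\pm}_{-Y}$ denotes the operator obtained from $J_Y^{(-1/b^2)}$ by substituting $p_n\mapsto(-ib)^{-1}a^{\pm}_{-n}$ for all $n\ge1$. The vector $J^+_{-Y_1}J^-_{-Y_2}|P\rangle$ lies in $\mathcal{F}_{|Y_1|,|Y_2|}$. It is a known property of Jack functions that $H_0J^+_{-Y_1}J^-_{-Y_2}|P\rangle=E_{Y_1,Y_2}(P)\,J^+_{-Y_1}J^-_{-Y_2}|P\rangle$. *)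

(* Defs.v *)
From HB Require Import structures.
From mathcomp Require Import all_boot all_order all_algebra finmap.
From mathcomp Require Import boolp classical_sets fsbigop reals.
From mathcomp Require Import complex.
(* malg: polynomials in infinitely many variables; mpoly: finitely many. Many
   names clash: unqualified ones are those of monalg, imported last. *)
From mathcomp Require Import mpoly.
From mathcomp Require Import monalg.

Set Implicit Arguments.
Unset Strict Implicit.
Unset Printing Implicit Defensive.

Import GRing.Theory Num.Theory.

Local Open Scope classical_set_scope.
Local Open Scope ring_scope.

Definition is_partition (Y : seq nat) : bool := sorted geq Y && (0%N \notin Y).

Definition dominated (mu la : seq nat) : Prop :=
  sumn mu = sumn la /\
  forall k : nat, (sumn (take k mu) <= sumn (take k la))%N.

(* K[p_1, p_2, ...]; the variable of index k is p_(k+1). *)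
Notation psymfun K := {malg K[{cmonom nat}]}.

(* Replaces p_n by x n for every n >= 1, and coefficients c by phi c. *)
Definition psum_eval (K : nzRingType) (S : comNzRingType) (phi : K -> S)
    (x : nat -> S) (f : psymfun K) : S :=
  mmap phi
    (fun m : {cmonom nat} => \prod_(k <- finsupp m) x k.+1 ^+ m k) f.

Definition psum_weight (m : {cmonom nat}) : nat :=
  (\sum_(k <- finsupp m) m k * k.+1)%N.

(* z_mu, for the partition mu in which the part k+1 occurs m k times *)
Definition zee (m : {cmonom nat}) : nat :=
  (\prod_(k <- finsupp m) (k.+1 ^ m k * (m k)`!))%N.

(* The Jack parameter alpha is the indeterminate 'X of {poly rat}. The
   integral forms are elements of Q(alpha)[p_1, p_2, ...] whose coefficients
   happen to be polynomials in alpha, so they live over Q[alpha]; this is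
   what allows alpha to be specialized to an arbitrary number. *)

(* <p_la, p_mu> = delta_(la, mu) z_la alpha^(length la) *)
Definition jack_scalar (f g : psymfun {poly rat}) : {poly rat} :=
  \sum_(m <- msupp f)
    mcoeff m f * mcoeff m g * (zee m)%:R * 'X^(mdeg m).

Definition in_variables (n : nat) (f : psymfun {poly rat}) :
    mpoly.mpoly n {poly rat} :=
  psum_eval (@mpolyC n {poly rat}) (fun k => \sum_(i < n) 'X_i ^+ k) f.

(* The coefficient of the monomial symmetric function m_mu in f, read off as
   the coefficient of x^mu; no information is lost since a partition mu of n
   has at most n parts. *)
Definition monomial_coeff (n : nat) (mu : seq nat) (f : psymfun {poly rat}) :
    {poly rat} :=
  mpoly.mcoeff [multinom nth 0%N mu i | i < n] (in_variables n f).

(* Stanley's and Macdonald's characterization, over Q(alpha): J la is a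
   combination of the m_mu with mu <= la in dominance order, distinct J la are
   orthogonal, and the coefficient of x_1 ... x_n in J la is n!. It determines
   J uniquely on partitions. *)
Record jack_family (J : seq nat -> psymfun {poly rat}) : Prop := JackFamily {
  jack_homogeneous : forall la, is_partition la ->
    forall m, m \in msupp (J la) -> psum_weight m = sumn la;
  jack_triangular : forall la mu, is_partition la -> is_partition mu ->
    sumn mu = sumn la ->
    monomial_coeff (sumn la) mu (J la) != 0 -> dominated mu la;
  jack_orthogonal : forall la mu, is_partition la -> is_partition mu ->
    la != mu -> jack_scalar (J la) (J mu) = 0;
  jack_normalized : forall la, is_partition la ->
    monomial_coeff (sumn la) (nseq (sumn la) 1%N) (J la) = ((sumn la)`!)%:R
}.

Section Fock.
Variable C : numClosedFieldType.

(* The variable (s, k) is the creation operator a^s_(-(k+1)), where s is true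
   for + and false for -; the vacuum |P> is the polynomial 1. *)
Local Notation fock := {malg C[{cmonom (bool * nat)%type}]}.

Definition vacuum : fock := 1.

Definition creation (s : bool) (k : nat) : fock := << ucm (s, k) >>.

(* n d/d(a^s_(-n)) with n = k+1 *)
Definition annihilation (s : bool) (k : nat) (v : fock) : fock :=
  \sum_(m <- msupp v)
    << k.+1%:R * (m (s, k))%:R * mcoeff m v *g divcm m (ucm (s, k)) >>.

Variable P : C.

(* The oscillator a^s_n; recall that Negz k is the integer -(k+1). *)
Definition osc (s : bool) (n : int) (v : fock) : fock :=
  match n with
  | Posz 0 => (if s then 'i * P else - ('i * P)) *: v
  | Posz k.+1 => annihilation s k v
  | Negz k => creation s k * v
  end.

Definition degree (s : bool) (m : {cmonom (bool * nat)%type}) : nat :=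
  (\sum_(x <- finsupp m | x.1 == s) m x * x.2.+1)%N.

(* The direct sum of the F_(m, n) over the pairs (m, n) satisfying D *)
Definition graded (D : nat -> nat -> Prop) (v : fock) : Prop :=
  forall k, k \in msupp v -> D (degree true k) (degree false k).

Definition fock_component (m n : nat) : fock -> Prop :=
  graded (fun m' n' => m' = m /\ n' = n).

Variable b : C.

Definition Qb : C := b + b^-1.

(* The sums \sum_(i \in A) are MathComp-Analysis's finitely supported sums:
   on a given vector only finitely many terms are nonzero. *)
Definition Hsign (s : bool) (v : fock) : fock :=
  - 'i *: (\sum_(p \in [set p : nat * nat | (0 < p.1)%N /\ (0 < p.2)%N])
      (osc s (- (p.1 + p.2)%:Z) (osc s p.1%:Z (osc s p.2%:Z v)) +
       osc s (- p.1%:Z) (osc s (- p.2%:Z) (osc s (p.1 + p.2)%:Z v))))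
  + \sum_(n \in [set n : nat | (0 < n)%N])
      (let w := osc s (- n%:Z) (osc s n%:Z v) in
       (Qb * n%:R) *: w - (2 * 'i) *: osc s 0 w)
  - ('i / 3) *: osc s 0 (osc s 0 (osc s 0 v)).

Definition H0 (v : fock) : fock := Hsign true v + Hsign false v.

Definition HI (v : fock) : fock :=
  \sum_(n \in [set n : nat | (0 < n)%N])
    (2 * Qb * n%:R) *: osc true (- n%:Z) (osc false n%:Z v).

Definition H (v : fock) : fock := H0 v + HI v.

Definition eigenvector (T : fock -> fock) (e : C) (v : fock) : Prop :=
  v != 0 /\ T v = e *: v.

Definition eigenvalue_on (W : fock -> Prop) (T : fock -> fock) (e : C) : Prop :=
  exists2 v, W v & eigenvector T e v.

(* The inverse of e - H0 on the subspace W (0 where there is none) *)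
Definition resolvent (W : fock -> Prop) (e : C) (w : fock) : fock :=
  xget (0 : fock) [set u | W u /\ e *: u - H0 u = w].

(* The element of the Fock space obtained from J^(alpha), alpha = -1/b^2, by
   p_n |-> (-ib)^(-1) a^s_(-n). Creation operators act by multiplication, so
   the operator J^s_(-Y) is the multiplication by this element. *)
Definition jack_creation (s : bool) (f : psymfun {poly rat}) : fock :=
  psum_eval (fun c => malgC (map_poly ratr c).[- (b ^+ 2)^-1])
    (fun n => (- ('i * b))^-1 *: creation s n.-1) f.

Definition jack_state (f1 f2 : psymfun {poly rat}) : fock :=
  jack_creation true f1 * (jack_creation false f2 * vacuum).

Definition energy1 (Y : seq nat) : C :=
  \sum_(i < size Y)
    ((nth 0%N Y i)%:R ^+ 2 * b^-1 + (2 * i.+1 - 1)%:R * (nth 0%N Y i)%:R * b).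

Definition energy (Y1 Y2 : seq nat) : C :=
  energy1 Y1 + energy1 Y2 + 2 * P * ((sumn Y1)%:R - (sumn Y2)%:R).

Definition generic (Y1 Y2 : seq nat) : Prop :=
  forall m n : nat, (m + n = sumn Y1 + sumn Y2)%N -> (sumn Y1 < m)%N ->
    ~ eigenvalue_on (fock_component m n) H0 (energy Y1 Y2).

Definition upper_space (Y1 Y2 : seq nat) : fock -> Prop :=
  graded (fun m n => (sumn Y1 < m)%N /\ (m + n = sumn Y1 + sumn Y2)%N).

Definition perturbed (Y1 Y2 : seq nat) (v : fock) : fock :=
  \sum_(n \in [set: nat])
    iter n (fun w => resolvent (upper_space Y1 Y2) (energy Y1 Y2) (HI w)) v.

End Fock.

(* Main.v *)
Require Import Defs.
From HB Require Import structures.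
From mathcomp Require Import all_boot all_order all_algebra finmap.
From mathcomp Require Import boolp classical_sets fsbigop.
From mathcomp Require mpoly.
From mathcomp Require Import ring zify.
From mathcomp Require Import reals complex monalg.

(* In the variables p_n = a_(-n) / (-i b), the operator H^+ (or H^-) is -2b times
   the Laplace-Beltrami operator of Jack parameter alpha = -1/b^2, plus a
   multiple of the degree and a constant.

   That Jack functions are eigenfunctions is proved over Q[alpha], before
   specializing alpha. In finitely many variables, this operator L applied to a
   symmetric polynomial whose monomials x^a satisfy sum a_i^2 <= k acts on the
   monomials with sum a_i^2 = k by a scalar e(a). So, for the Jack function J of
   lambda, g = (L - e(lambda)) J only involves monomials of smaller sum of
   squares than lambda, and so does (L - e(lambda)) g. Such functions are
   combinations of the Jack functions of other partitions, hence orthogonal to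
   J; as L is self-adjoint, <g, g> = <J, (L - e(lambda)) g> = 0, and g = 0 since
   the form is positive definite at positive rational alpha.

   On the Fock space, genericity makes E - H_0 injective, hence bijective, on
   the finite-dimensional sum of the F_(m, n) with m > |Y_1|. The terms v_n of
   the series satisfy (E - H_0) v_0 = 0, (E - H_0) v_(n+1) = H_I v_n and v_n = 0
   for n > |Y_2|, and the series telescopes; its component in
   F_(|Y_1|, |Y_2|) is v_0, which is nonzero because the coefficient of
   x_1 ... x_n in the Jack functions is n! for every alpha. *)

Set Implicit Arguments.
Unset Strict Implicit.
Unset Printing Implicit Defensive.

Import Order.TTheory GRing.Theory Num.Theory.

Local Open Scope ring_scope.

(** The passage through an indeterminate alpha is forced: at alpha = -1/b^2 the scalar product need
    not be definite, whereas the eigenvalue equation is a polynomial identity in alpha and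
    specializes freely. As Q[alpha] is not a field, coefficients are eliminated by
    cross-multiplication instead of expanding in Jack functions. The value of alpha comes from the
    substitution: with c = 1/(-ib), the oscillator a_n is n c d/dp_n and a_(-n) is p_n / c, so the
    two cubic terms of the Hamiltonian get the factors -ic = -b alpha and -i/c = -b. The coefficient
    -b (alpha - 1) of the quadratic term is then exactly Q. For the nonvanishing, the leading
    coefficient in dominance order is of no help, since it may vanish at such an alpha (for p_1^2 +
    alpha p_2 it is 1 + alpha). The coefficient of x_1 ... x_n can only come from p_1^n, so the
    coefficient of p_1^n never vanishes. *)

Local Notation "m1 *c m2" := (mmul m1 m2) (at level 40, left associativity).

(** * Partial derivatives and power sums *)

(* Locked: unification would otherwise loop trying to unfold it. *)
HB.lock Definition pderiv (I : choiceType) (K : comNzRingType) (x : I)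
    (f : {malg K[{cmonom I}]}) : {malg K[{cmonom I}]} :=
  \sum_(m <- msupp f) << f@_m *+ m x *g divcm m (ucm x) >>.
Canonical pderiv_unlockable := Unlockable pderiv.unlock.

Section Derivations.
Context {I : choiceType}.
Implicit Types (x y : I) (m : {cmonom I}).

Lemma mulcm_divcm x m : (0 < m x)%N -> divcm m (ucm x) *c ucm x = m.
Proof.
move=> mx; apply/eqP/cmP => i; rewrite cmM divcmE ucmE subnK //.
by case: eqVneq => // <-.
Qed.

Lemma divcm_mulcm x m : divcm (m *c ucm x) (ucm x) = m.
Proof. by apply/eqP/cmP => i; rewrite divcmE cmM addnK. Qed.

Lemma divcm_mull x m m' : (0 < m x)%N ->
  divcm (m *c m') (ucm x) = divcm m (ucm x) *c m'.
Proof.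
move=> mx; apply/eqP/cmP => i; rewrite !(divcmE, cmM) ucmE addnBAC //.
by case: eqVneq => // <-.
Qed.

Lemma cmonom_ind (Q : {cmonom I} -> Prop) :
  Q mone -> (forall x m, Q m -> Q (m *c ucm x)) -> forall m, Q m.
Proof.
move=> Q1 Qu m; move: {-2}m (leqnn (mdeg m)); elim: (mdeg m) => [|d IH] {}m.
  by rewrite leqn0 => /eqP/mdeg_eq0I ->.
have [->|m1] := eqVneq m mone; first by [].
have [x mx] : exists x, (0 < m x)%N.
  apply/not_existsP => h; case/eqP: m1; apply/eqP/cmP => i; rewrite cm1.
  by apply/eqP; rewrite -leqn0 leqNgt; apply/negP/h.
rewrite -(mulcm_divcm mx) mdegM mdegU addn1 ltnS => le_d; exact/Qu/IH.
Qed.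

Lemma msupp_cmonom m x : (x \in finsupp m) = (0 < m x)%N.
Proof. by rewrite -cmE_neq0 lt0n. Qed.

Variable K : comNzRingType.
Implicit Types (f g : {malg K[{cmonom I}]}).

(** The defining sum runs over the support of [f], which hides linearity and the commutation of
    derivatives; both are read off from this coefficientwise form. *)
Lemma mcoeff_pderiv x f m :
  (pderiv x f)@_m = f@_(m *c ucm x) *+ (m x).+1.
Proof.
rewrite unlock raddf_sum /=.
have cE m' : << f@_m' *+ m' x *g divcm m' (ucm x) >>@_m
   = if m' == m *c ucm x then f@_(m *c ucm x) *+ (m x).+1 else 0.
  rewrite mcoeffU; case: eqVneq => [<-|ne].
    case: eqVneq => [e|ne].
      by rewrite mulr1n e cmM cmUU divcm_mulcm addn1.
    case: (posnP (m' x)) => [->|mx]; first by rewrite mulr0n.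
    by rewrite mulcm_divcm // eqxx in ne.
  case: eqVneq => [e|//]; by rewrite e divcm_mulcm eqxx in ne.
rewrite (eq_bigr _ (fun m' _ => cE m')) -big_mkcond /=.
case: (boolP (m *c ucm x \in msupp f)) => [mf|mf].
  rewrite -big_filter filter_pred1_uniq ?fset_uniq //.
  by rewrite big_seq1.
rewrite big1_seq => [|m' /andP[/eqP-> mf']]; last by rewrite mf' in mf.
by rewrite mcoeff_outdom ?mul0rn.
Qed.

Lemma pderiv_is_linear x : linear (@pderiv I K x).
Proof.
suff lin c f g : pderiv x (c *: f + g) = c *: pderiv x f + pderiv x g by [].
apply/malgP => m.
by rewrite mcoeff_pderiv !mcoeffD !mcoeffZ !mcoeff_pderiv mulrnDl mulrnAr.
Qed.
HB.instance Definition _ x := GRing.isLinear.Build K {malg K[{cmonom I}]}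
  {malg K[{cmonom I}]} _ (@pderiv I K x) (pderiv_is_linear x).

Lemma pderiv0 x : pderiv x 0 = 0 :> {malg K[{cmonom I}]}.
Proof. exact: linear0. Qed.

Lemma pderivD x f g : pderiv x (f + g) = pderiv x f + pderiv x g.
Proof. exact: linearD. Qed.

Lemma pderivZ x c f : pderiv x (c *: f) = c *: pderiv x f.
Proof. exact: linearZ. Qed.

Lemma pderivU x c m :
  @pderiv I K x << c *g m >> = << c *+ m x *g divcm m (ucm x) >>.
Proof.
apply/malgP => m'; rewrite mcoeff_pderiv !mcoeffU.
case: (eqVneq m (m' *c ucm x)) => [->|ne].
  by rewrite divcm_mulcm eqxx cmM cmUU addn1 !mulr1n.
rewrite mul0rn; case: (posnP (m x)) => [->|mx]; first by rewrite mulr0n mul0rn.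
case: eqVneq => [e|]; last by rewrite mulr0n.
by rewrite -e mulcm_divcm // eqxx in ne.
Qed.

Lemma pderivC x (c : K) : @pderiv I K x c%:MP = 0.
Proof. by rewrite pderivU cm1 mulr0n monalgU0. Qed.

Lemma pderiv_ucm x y : @pderiv I K x << ucm y >> = (x == y)%:R.
Proof.
rewrite pderivU ucmE eq_sym; case: eqVneq => [->|_]; last first.
  by rewrite mulr0n monalgU0.
by rewrite mulr1n -{1}[ucm y]mul1m divcm_mulcm.
Qed.

Lemma mul_monom (c d : K) m m' : << c *g m >> * << d *g m' >> =
  << c * d *g m *c m' >> :> {malg K[{cmonom I}]}.
Proof. by rewrite malgM_def fgmulUU. Qed.

Lemma malg_ind_supp (Q : {malg K[{cmonom I}]} -> Prop) :
  Q 0 -> (forall f g, Q f -> Q g -> Q (f + g)) ->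
  forall f, (forall m, m \in msupp f -> Q << f@_m *g m >>) -> Q f.
Proof.
move=> Q0 QD f Qm; rewrite (monalgE f) big_seq_cond.
by apply: (big_ind Q) => // m; rewrite andbT => /Qm.
Qed.

Lemma malg_ind (Q : {malg K[{cmonom I}]} -> Prop) :
  Q 0 -> (forall f g, Q f -> Q g -> Q (f + g)) ->
  (forall c m, Q << c *g m >>) -> forall f, Q f.
Proof. by move=> Q0 QD QU f; apply: malg_ind_supp. Qed.

Lemma malg_additive_ext (V : zmodType) (d1 d2 : {malg K[{cmonom I}]} -> V) :
  {morph d1 : f g / f + g} -> {morph d2 : f g / f + g} ->
  (forall c m, d1 << c *g m >> = d2 << c *g m >>) -> d1 =1 d2.
Proof.
move=> D1 D2 e; apply: malg_ind => [|f g e1 e2|c m]; last exact: e.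
- have d0 (d : {malg K[{cmonom I}]} -> V) : {morph d : f g / f + g} -> d 0 = 0.
    by move=> D; apply: (addIr (d 0)); rewrite -D !add0r.
  by rewrite !d0.
- by rewrite D1 D2 e1 e2.
Qed.

Lemma pderivM x f g : pderiv x (f * g) = pderiv x f * g + f * pderiv x g.
Proof.
pose d1 f g := pderiv x (f * g); pose d2 f g := pderiv x f * g + f * pderiv x g.
have d1Dl h : {morph d1^~ h : f g / f + g}.
  by move=> f1 f2; rewrite /d1 mulrDl pderivD.
have d1Dr h : {morph d1 h : f g / f + g}.
  by move=> f1 f2; rewrite /d1 mulrDr pderivD.
have d2Dl h : {morph d2^~ h : f g / f + g}.
  by move=> f1 f2; rewrite /d2 pderivD mulrDl (mulrDl f1 f2); exact: addrACA.
have d2Dr h : {morph d2 h : f g / f + g}.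
  by move=> f1 f2; rewrite /d2 pderivD mulrDr (mulrDr h); exact: addrACA.
apply: (malg_additive_ext (d1Dl g) (d2Dl g)) => c m.
apply: (malg_additive_ext (d1Dr _) (d2Dr _)) => d m'; rewrite /d1 /d2.
rewrite -> mul_monom, !pderivU, !mul_monom.
rewrite cmM mulrnDr monalgUD mulrnAl mulrnAr.
apply: f_equal2.
  case: (posnP (m x)) => [->|mx]; first by rewrite !mulr0n !monalgU0.
  by rewrite (divcm_mull _ mx).
case: (posnP (m' x)) => [->|mx]; first by rewrite !mulr0n !monalgU0.
by rewrite mulmC (divcm_mull _ mx) mulmC.
Qed.

Lemma pderivC_comm x y f : pderiv x (pderiv y f) = pderiv y (pderiv x f).
Proof.
apply/malgP => m; rewrite !mcoeff_pderiv.
rewrite -!mulmA (mulmC (ucm x)) !cmM !ucmE -!mulrnA; congr (_ *+ _).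
rewrite (eq_sym x y); case: eqVneq => [->|]; first by [].
by rewrite !addn0 mulnC.
Qed.

(** The variables are limited to a set [A] so that a chain-rule sum truncated to finitely many
    variables can be compared with a derivation. *)
Lemma derivation_ext (S : comNzRingType)
    (phi : {rmorphism {malg K[{cmonom I}]} -> S})
    (d1 d2 : {malg K[{cmonom I}]} -> S) (A : I -> Prop) :
  {morph d1 : f g / f + g} -> {morph d2 : f g / f + g} ->
  (forall f g, d1 (f * g) = d1 f * phi g + phi f * d1 g) ->
  (forall f g, d2 (f * g) = d2 f * phi g + phi f * d2 g) ->
  (forall c : K, d1 c%:MP = d2 c%:MP) ->
  (forall x, A x -> d1 << ucm x >> = d2 << ucm x >>) ->
  forall f, (forall m, m \in msupp f -> forall x, (0 < m x)%N -> A x) ->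
  d1 f = d2 f.
Proof.
move=> D1 D2 L1 L2 eC eU f Af.
apply: (malg_ind_supp (Q := fun g => d1 g = d2 g)) => [|g h e1 e2|m mf].
- have := eC 0; by rewrite monalgU0.
- by rewrite D1 D2 e1 e2.
have := Af _ mf; move: (f@_m) => c {f Af mf}.
elim/cmonom_ind: m => [_|x m IH Am]; first exact: eC.
have -> : << c *g m *c ucm x >> = << c *g m >> * << ucm x >> :> {malg K[{cmonom I}]}.
  by rewrite mul_monom mulr1.
have Ax : A x by apply: Am; rewrite cmM cmUU addn1.
have {}IH : d1 << c *g m >> = d2 << c *g m >>.
  by apply: IH => y my; apply: Am; rewrite cmM addn_gt0 my.
by rewrite -> L1, L2, IH; congr (_ + _ * _); exact: eU.
Qed.

End Derivations.

(** * Monomials and supports *)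

Section Monomials.
Context {I : choiceType}.
Implicit Types (x : I) (m : {cmonom I}).

Lemma big_finsuppw (T : Type) (idx : T) (op : Monoid.com_law idx)
    (F : I -> nat -> T) (d : {fset I}) m :
  (forall x, F x 0%N = idx) -> {subset finsupp m <= d} ->
  \big[op/idx]_(x <- finsupp m) F x (m x) = \big[op/idx]_(x <- d) F x (m x).
Proof.
move=> F0 /fsubsetP le_d; apply: (big_fset_incl _ le_d) => x _.
by rewrite -cmE_neq0 negbK => /eqP ->.
Qed.

(** Covers what is computed exponent by exponent: evaluation at a point, weight of a power-sum
    monomial, bidegree of a Fock monomial. *)
Lemma big_finsuppM (T : Type) (idx : T) (op : Monoid.com_law idx)
    (F : I -> nat -> T) m m' :
  (forall x, F x 0%N = idx) ->
  (forall x i j, F x (i + j)%N = op (F x i) (F x j)) ->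
  \big[op/idx]_(x <- finsupp (m *c m')) F x ((m *c m') x) =
  op (\big[op/idx]_(x <- finsupp m) F x (m x))
     (\big[op/idx]_(x <- finsupp m') F x (m' x)).
Proof.
move=> F0 FD; rewrite (big_finsuppw op (d := finsupp (m *c m')) (m := m)) //.
  rewrite (big_finsuppw op (d := finsupp (m *c m')) (m := m')) //.
    by rewrite -big_split; apply: eq_bigr => x _; rewrite cmM FD.
  by move=> x; rewrite !msupp_cmonom cmM addn_gt0 => ->; rewrite orbT.
by move=> x; rewrite !msupp_cmonom cmM addn_gt0 => ->.
Qed.

Lemma big_finsuppU (T : Type) (idx : T) (op : Monoid.com_law idx)
    (F : I -> nat -> T) x :
  \big[op/idx]_(y <- finsupp (ucm x)) F y (ucm x y) = F x 1%N.
Proof. by rewrite mdomU big_seq_fset1 cmUU. Qed.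

Definition monom_eval (S : comNzRingType) (v : I -> S) m : S :=
  \prod_(x <- finsupp m) v x ^+ m x.

Lemma monom_evalM (S : comNzRingType) (v : I -> S) : mmorphism (monom_eval v).
Proof.
split=> [m m'|]; rewrite /monom_eval; last by rewrite mdom1 big_seq_fset0.
rewrite (@big_finsuppM _ _ _ (fun x i => v x ^+ i)) // => x i j.
exact: exprD.
Qed.
HB.instance Definition _ (S : comNzRingType) (v : I -> S) :=
  isMultiplicative.Build _ _ (monom_eval v) (monom_evalM v).

(** Homogeneity, bounds on mode numbers and the grading of the Fock space are all of this form and
    share the closure lemmas below. *)
Definition supported (K : comNzRingType) (D : {cmonom I} -> Prop)
    (f : {malg K[{cmonom I}]}) : Prop :=
  forall m, m \in msupp f -> D m.

Variable K : comNzRingType.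
Implicit Types (f g : {malg K[{cmonom I}]}) (D : {cmonom I} -> Prop).

Lemma supportedP D f : supported D f <-> (forall m, f@_m != 0 -> D m).
Proof. by split=> h m mf; apply: h; rewrite ?mcoeff_neq0 // -mcoeff_neq0. Qed.

Lemma supported0 D : supported D (0 : {malg K[{cmonom I}]}).
Proof. by move=> m; rewrite -mcoeff_neq0 mcoeff0 eqxx. Qed.

Lemma supportedD D f g : supported D f -> supported D g -> supported D (f + g).
Proof.
move=> /supportedP hf /supportedP hg; apply/supportedP => m.
rewrite mcoeffD; have [->|/hf //] := eqVneq f@_m 0.
by rewrite add0r => /hg.
Qed.

Lemma supportedZ D (c : K) f : supported D f -> supported D (c *: f).
Proof.
move=> /supportedP hf; apply/supportedP => m; rewrite mcoeffZ.
by have [->|/hf //] := eqVneq f@_m 0; rewrite mulr0 eqxx.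
Qed.

Lemma supportedB D f g : supported D f -> supported D g -> supported D (f - g).
Proof.
move=> hf hg; have -> : f - g = f + (-1) *: g by rewrite scaleN1r.
by apply: supportedD => //; exact: supportedZ.
Qed.

Lemma supported_sum (J : Type) (r : seq J) (Q : pred J) D
    (F : J -> {malg K[{cmonom I}]}) :
  (forall j, Q j -> supported D (F j)) -> supported D (\sum_(j <- r | Q j) F j).
Proof.
move=> h; apply: (big_ind (supported D)) => //; first exact: supported0.
exact: supportedD.
Qed.

Lemma supportedW D D' f :
  (forall m, D m -> D' m) -> supported D f -> supported D' f.
Proof. by move=> DD' h m /h /DD'. Qed.

Lemma supported_pderiv x D f :
  supported D f -> supported (fun m => D (m *c ucm x)) (pderiv x f).
Proof.
move=> /supportedP hf; apply/supportedP => m; rewrite mcoeff_pderiv => nz.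
by apply: hf; apply: contra_neq nz => ->; rewrite mul0rn.
Qed.

Lemma supportedM D D1 D2 f g : supported D1 f -> supported D2 g ->
  (forall m1 m2, D1 m1 -> D2 m2 -> D (m1 *c m2)) -> supported D (f * g).
Proof.
move=> h1 h2 DM m /msuppM_le [] m1 [] m2 [] m1f m2g ->.
exact: DM (h1 _ _) (h2 _ _).
Qed.

Lemma supported_ucm x : supported (eq (ucm x)) (<< ucm x >> : {malg K[{cmonom I}]}).
Proof. by move=> m /(fsubsetP msuppU_le); rewrite inE => /eqP ->. Qed.

Lemma supported_mul_ucm x D f : supported D f ->
  supported (fun m => exists2 m', D m' & m = m' *c ucm x) (<< ucm x >> * f).
Proof.
move=> h; apply: (supportedM (@supported_ucm x) h) => _ m <- Dm.
by exists m => //; rewrite mulmC.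
Qed.

Lemma pderiv_eq0 x f : supported (fun m => m x = 0%N) f -> pderiv x f = 0.
Proof.
move=> /supportedP h; apply/malgP => m; rewrite mcoeff_pderiv mcoeff0.
have [->|/h] := eqVneq f@_(m *c ucm x) 0; first by rewrite mul0rn.
by rewrite cmM cmUU addn1.
Qed.

End Monomials.

(** * Weight and chain rule for power sums *)

Section PowerSums.
Variable K : comNzRingType.
Implicit Types (f g : psymfun K) (m : {cmonom nat}).

Lemma psum_weightM m m' :
  psum_weight (m *c m') = (psum_weight m + psum_weight m')%N.
Proof.
apply: (@big_finsuppM _ _ _ _ (fun x i => (i * x.+1)%N)) => // x i j.
exact: mulnDl.
Qed.

Lemma psum_weightU k : psum_weight (ucm k) = k.+1.
Proof.
by rewrite /psum_weight (big_finsuppU _ (fun x i => (i * x.+1)%N)) mul1n.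
Qed.

Lemma psum_weight_ge m k : (m k * k.+1 <= psum_weight m)%N.
Proof.
have [mk|] := boolP (k \in finsupp m).
  by rewrite /psum_weight (big_fsetD1 k) //= leq_addr.
by rewrite -cmE_eq0 => /eqP ->.
Qed.

Lemma psum_weight_lt m k : (0 < m k)%N -> (k < psum_weight m)%N.
Proof.
move=> mk; apply: leq_trans (psum_weight_ge m k).
by rewrite -[X in (X <= _)%N]mul1n leq_mul.
Qed.

Definition psum_homog (n : nat) f : Prop := supported (fun m => psum_weight m = n) f.

Lemma psum_homog_pderiv n k f : psum_homog n f -> psum_homog (n - k.+1) (pderiv k f).
Proof.
move=> /(supported_pderiv (x := k)); apply: supportedW => m.
by rewrite psum_weightM psum_weightU => <-; rewrite addnK.
Qed.

(** Both sides are derivations along [phi] that kill constants and agree on variables. The variable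
    of index [k] has weight [k.+1], so a weight at most [N] leaves only the indices below [N]. *)
Lemma chain_rule (S : comNzRingType) (phi : {rmorphism psymfun K -> S})
    (d : S -> S) (N : nat) f :
  {morph d : a b / a + b} ->
  (forall a b, d (a * b) = d a * b + a * d b) ->
  (forall c : K, d (phi c%:MP) = 0) ->
  supported (fun m => psum_weight m <= N)%N f ->
  d (phi f) = \sum_(k < N) phi (pderiv (k : nat) f) * d (phi << ucm (k : nat) >>).
Proof.
move=> dD dM dC hf.
pose d2 f := \sum_(k < N) phi (pderiv (k : nat) f) * d (phi << ucm (k : nat) >>).
apply: (derivation_ext (d1 := d \o phi) (d2 := d2) (phi := phi)
  (A := fun k => k < N)%N) => /=.
- by move=> g h /=; rewrite rmorphD dD.
- move=> g h; rewrite /d2 -big_split; apply: eq_bigr => k _ /=.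
  by rewrite pderivD rmorphD mulrDl.
- by move=> g h; rewrite rmorphM dM.
- move=> g h; rewrite /d2 mulr_suml mulr_sumr -big_split.
  apply: eq_bigr => k _ /=.
  have -> : phi (pderiv (k : nat) (g * h)) =
      phi (pderiv (k : nat) g) * phi h + phi g * phi (pderiv (k : nat) h).
    by rewrite pderivM rmorphD; congr (_ + _); exact: rmorphM.
  by rewrite mulrDl mulrAC mulrA.
- move=> c; rewrite dC /d2 big1 // => k _.
  by rewrite pderivC rmorph0 mul0r.
- move=> k kN; rewrite /d2 (bigD1 (Ordinal kN)) //= big1 => [|j jk].
    rewrite addr0 -[LHS]mul1r; congr (_ * _).
    by rewrite (congr1 phi (pderiv_ucm K k k)) eqxx rmorph1.
  have jk' : ((j : nat) == k) = false.
    by apply: contra_neqF jk => /eqP jk; apply/val_inj.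
  by rewrite (congr1 phi (pderiv_ucm K (j : nat) k)) jk' rmorph0 mul0r.
- move=> m mf k mk; exact: leq_trans (psum_weight_lt mk) (hf m mf).
Qed.

Variables (S : comNzRingType) (phi : {rmorphism K -> S}) (x : nat -> S).

HB.instance Definition _ := GRing.RMorphism.copy (psum_eval phi x)
  (mmap phi (monom_eval (fun k => x k.+1))).

Lemma psum_evalC (c : K) : psum_eval phi x c%:MP = phi c.
Proof. exact: (mmapC (h := monom_eval (fun k => x k.+1))). Qed.

Lemma psum_evalU k : psum_eval phi x << ucm k >> = x k.+1.
Proof.
transitivity (phi 1 * monom_eval (fun k => x k.+1) (ucm k)).
  exact: mmapU.
by rewrite rmorph1 mul1r /monom_eval (big_finsuppU _ (fun k i => x k.+1 ^+ i)).
Qed.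

Lemma psum_evalZ (c : K) f : psum_eval phi x (c *: f) = phi c * psum_eval phi x f.
Proof. exact: (mmapZ (h := monom_eval (fun k => x k.+1))). Qed.

End PowerSums.

(** * The Jack scalar product and the Laplace-Beltrami operator *)

Section JackScalar.
Variables (K : comNzRingType) (a : K).
Implicit Types (f g h : psymfun K) (m : {cmonom nat}).

(** [jack_scalar] is, by conversion, the case of [{poly rat}] with parameter ['X]. *)
Definition psum_scalar f g : K :=
  \sum_(m <- msupp f) f@_m * g@_m * (zee m)%:R * a ^+ mdeg m.

Lemma psum_scalarEw (d : {fset {cmonom nat}}) f g :
  {subset msupp f <= d} -> psum_scalar f g =
    \sum_(m <- d) f@_m * g@_m * (zee m)%:R * a ^+ mdeg m.
Proof.
move=> /fsubsetP le_d; apply: (big_fset_incl _ le_d) => m _.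
by move/mcoeff_outdom ->; rewrite !mul0r.
Qed.

Lemma psum_scalarC f g : psum_scalar f g = psum_scalar g f.
Proof.
rewrite (@psum_scalarEw (msupp f `|` msupp g)%fset); last first.
  by move=> m mf; rewrite inE mf.
rewrite (@psum_scalarEw (msupp f `|` msupp g)%fset g); last first.
  by move=> m mf; rewrite inE mf orbT.
by apply: eq_bigr => m _; rewrite (mulrC f@_m).
Qed.

Lemma psum_scalarDr f g h :
  psum_scalar f (g + h) = psum_scalar f g + psum_scalar f h.
Proof.
rewrite -big_split; apply: eq_bigr => m _ /=.
by rewrite mcoeffD mulrDr !mulrDl.
Qed.

Lemma psum_scalarZr c f g : psum_scalar f (c *: g) = c * psum_scalar f g.
Proof.
by rewrite mulr_sumr; apply: eq_bigr => m _; rewrite mcoeffZ !mulrA (mulrC c).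
Qed.

Lemma psum_scalarDl f g h :
  psum_scalar (f + g) h = psum_scalar f h + psum_scalar g h.
Proof. by rewrite psum_scalarC psum_scalarDr !(psum_scalarC h). Qed.

Lemma psum_scalarZl c f g : psum_scalar (c *: f) g = c * psum_scalar f g.
Proof. by rewrite psum_scalarC psum_scalarZr psum_scalarC. Qed.

Lemma psum_scalar0l g : psum_scalar 0 g = 0.
Proof. by rewrite /psum_scalar msupp0 big_seq_fset0. Qed.

Lemma psum_scalarBl f g h :
  psum_scalar (f - g) h = psum_scalar f h - psum_scalar g h.
Proof.
have -> : f - g = f + (-1) *: g by rewrite scaleN1r.
by rewrite psum_scalarDl psum_scalarZl mulN1r.
Qed.

Lemma psum_scalar_suml (T : Type) (r : seq T) (F : T -> psymfun K) g :
  psum_scalar (\sum_(t <- r) F t) g = \sum_(t <- r) psum_scalar (F t) g.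
Proof.
by apply: (big_morph (psum_scalar^~ g)) => [f h|];
  rewrite ?psum_scalarDl ?psum_scalar0l.
Qed.

Lemma psum_scalarUl c m g :
  psum_scalar << c *g m >> g = c * g@_m * (zee m)%:R * a ^+ mdeg m.
Proof.
rewrite (@psum_scalarEw [fset m]%fset); last exact/fsubsetP/msuppU_le.
by rewrite big_seq_fset1 mcoeffUU.
Qed.

Lemma zeeMU m k : zee (m *c ucm k) = (zee m * (k.+1 * (m k).+1))%N.
Proof.
rewrite /zee (big_finsuppw _ (F := fun k i => (k.+1 ^ i * i`!)%N)
  (d := finsupp (m *c ucm k)) (m := m)) //; last first.
  by move=> j; rewrite !msupp_cmonom cmM addn_gt0 => ->.
rewrite (big_fsetD1 k) /=; last by rewrite msupp_cmonom cmM cmUU addn1.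
rewrite [in RHS](big_fsetD1 k) /=; last by rewrite msupp_cmonom cmM cmUU addn1.
rewrite cmM cmUU addn1 factS expnS.
rewrite (eq_big_seq (fun i => i.+1 ^ m i * (m i)`!)%N) => [|j].
  by move: (\prod_(_ <- _) _)%N (_ ^ _)%N (_`!) => S e q; ring.
by rewrite !inE cmM cmU eq_sym => /andP[/negbTE -> _]; rewrite addn0.
Qed.

(** Adding a part [k.+1] to [m] multiplies [zee] by [k.+1 * (m k).+1] and brings one more factor
    [a]; the factor [(m k).+1] is the one produced by the derivative. *)
Lemma psum_scalar_adjoint k f g :
  psum_scalar (<< ucm k >> * f) g = a * k.+1%:R * psum_scalar f (pderiv k g).
Proof.
apply: (malg_additive_ext (d1 := fun f => psum_scalar (<< ucm k >> * f) g)
  (d2 := fun f => a * k.+1%:R * psum_scalar f (pderiv k g))) f.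
- by move=> f h; rewrite mulrDr psum_scalarDl.
- by move=> f h; rewrite psum_scalarDl mulrDr.
move=> c m; rewrite -> mul_monom, psum_scalarUl, psum_scalarUl.
rewrite -> mcoeff_pderiv; rewrite mulmC zeeMU mdegM mdegU addn1 exprS.
move: (zee m) (g@_(m *c ucm k)) (a ^+ mdeg m) => z y e.
by rewrite mul1r -mulr_natr !natrM; ring.
Qed.

(* Twice the Laplace-Beltrami operator with Jack parameter a, truncated to the
   variables p_1, ..., p_N:
   sum_(i, j >= 1) (a i j p_(i+j) d_i d_j + (i + j) p_i p_j d_(i+j))
   + (a - 1) sum_(i >= 1) i (i - 1) p_i d_i. *)
Definition jack_op (N : nat) f : psymfun K :=
  \sum_(i < N) \sum_(j < N)
    ((a * (i.+1 * j.+1)%:R) *: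
       (<< ucm (i + j).+1 >> * pderiv (i : nat) (pderiv (j : nat) f)) +
     (i + j).+2%:R *:
       (<< ucm (i : nat) >> * (<< ucm (j : nat) >> * pderiv (i + j).+1 f)))
  + \sum_(i < N) ((a - 1) * (i.+1 * i)%:R) *:
      (<< ucm (i : nat) >> * pderiv (i : nat) f).

(** Once every multiplication has been moved to the other side, the two cubic terms of [jack_op]
    carry the same weight and are exchanged by swapping [f] and [g]; self-adjointness becomes
    visible. *)
Lemma psum_scalar_jack_op N f g : psum_scalar (jack_op N f) g =
  \sum_(i < N) \sum_(j < N) a ^+ 2 * (i.+1 * j.+1 * (i + j).+2)%:R *
    (psum_scalar (pderiv (i : nat) (pderiv (j : nat) f)) (pderiv (i + j).+1 g) +
     psum_scalar (pderiv (i : nat) (pderiv (j : nat) g)) (pderiv (i + j).+1 f))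
  + \sum_(i < N) ((a - 1) * (i.+1 * i)%:R) * (a * i.+1%:R) *
      psum_scalar (pderiv (i : nat) f) (pderiv (i : nat) g).
Proof.
rewrite psum_scalarDl !psum_scalar_suml; apply: f_equal2; last first.
  apply: eq_bigr => i _.
  by rewrite psum_scalarZl psum_scalar_adjoint -!mulrA.
apply: eq_bigr => i _; rewrite psum_scalar_suml; apply: eq_bigr => j _.
rewrite -> psum_scalarDl, !psum_scalarZl, !psum_scalar_adjoint.
rewrite -> (psum_scalarC (pderiv (i + j).+1 f)); rewrite /reverse_coercion.
rewrite -> (pderivC_comm (j : nat) i g).
move: (psum_scalar _ _) (psum_scalar _ _) => u v.
by rewrite !natrM; ring.
Qed.

Lemma jack_op_adjoint N f g :
  psum_scalar (jack_op N f) g = psum_scalar f (jack_op N g).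
Proof.
rewrite (psum_scalarC f); rewrite -> !psum_scalar_jack_op; apply: f_equal2.
  by do 2!apply: eq_bigr => ? _; congr (_ * _); rewrite addrC.
by apply: eq_bigr => i _; rewrite psum_scalarC.
Qed.

Lemma psum_homog_jack_op n N f : psum_homog n f -> psum_homog n (jack_op N f).
Proof.
move=> hf; have hd k := supported_pderiv (x := k) hf.
apply: supportedD; apply: supported_sum => i _; last first.
  apply: supportedZ.
  by apply: supportedW (supported_mul_ucm (x := (i : nat)) (hd i)) => m [m' <- ->].
apply: supported_sum => j _; apply: supportedD; apply: supportedZ.
  apply: supportedW (supported_mul_ucm (x := (i + j).+1)
    (supported_pderiv (x := (i : nat)) (hd j))) => m [m' <- ->].
  by rewrite !psum_weightM !psum_weightU; lia.
apply: supportedW (supported_mul_ucm (x := (i : nat))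
  (supported_mul_ucm (x := (j : nat)) (hd (i + j).+1))) => m [_ [m' <- ->] ->].
by rewrite !psum_weightM !psum_weightU; lia.
Qed.

End JackScalar.

Lemma zee_gt0 m : (0 < zee m)%N.
Proof. by apply: prodn_gt0 => k; rewrite muln_gt0 expn_gt0 fact_gt0. Qed.

Lemma exists_pos_nonroot (p : {poly rat}) : p != 0 -> exists2 t, 0 < t & ~~ root p t.
Proof.
move=> p0; apply/not_exists2P => h.
pose rs := [seq (i.+1%:R : rat) | i <- iota 0 (size p)].
have : (size rs < size p)%N.
  apply: max_poly_roots => //.
    apply/allP => _ /mapP[i _ ->].
    have [|/negP] := h i.+1%:R; first by rewrite ltr0Sn.
    by rewrite negbK.
  rewrite map_inj_uniq ?iota_uniq // => i j /eqP.
  by rewrite eqr_nat => /eqP [].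
by rewrite size_map size_iota ltnn.
Qed.

(* At a positive rational value of the Jack parameter the form is a sum of
   squares with positive weights. *)
Lemma jack_scalar_eq0 (f : psymfun {poly rat}) : jack_scalar f f = 0 -> f = 0.
Proof.
move=> ff0; apply/eqP; apply: contra_eqT ff0 => nzf.
have [m mf] : exists m, m \in msupp f.
  by apply/fset0Pn; rewrite msupp_eq0.
have [t t0 nrt] : exists2 t, 0 < t & ~~ root f@_m t.
  by apply: exists_pos_nonroot; rewrite mcoeff_neq0.
apply: contraNneq nrt => /(congr1 (horner^~ t)).
rewrite horner_sum horner0 => /eqP; rewrite psumr_eq0 => [|m' _]; last first.
  rewrite !hornerM hornerXn hornerMn hornerC.
  apply: mulr_ge0; last by rewrite exprn_ge0 // ltW.
  by apply: mulr_ge0; rewrite ?ler0n // -expr2 sqr_ge0.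
move=> /allP/(_ m mf) /=.
rewrite !hornerM hornerXn hornerMn hornerC !mulf_eq0 orbb pnatr_eq0.
by rewrite expf_eq0 (gt_eqF t0) andbF orbF eqn0Ngt zee_gt0 orbF.
Qed.

(** * The Laplace-Beltrami operator as a differential operator in finitely many variables *)

Section ReindexSum.
Variables (S : comNzRingType) (N : nat).

(** Groups the pairs by [k = i + j + 1], the index of the variable that the cubic terms attach to
    the pair; [k = 0] gives an empty sum. *)
Lemma sum_by_total (F : nat -> nat -> S) :
  (forall i j, (N <= (i + j).+1)%N -> F i j = 0) ->
  \sum_(i < N) \sum_(j < N) F i j =
  \sum_(k < N) \sum_(i < k) F (k.-1 - i)%N i.
Proof.
move=> F0.
have e1 (j : 'I_N) : \sum_(i < N) F i j = \sum_(k < N | (j < k)%N) F (k.-1 - j)%N j.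
  have jN : (j.+1 <= N)%N by [].
  rewrite -(big_mkord xpredT (fun i => F i j)).
  rewrite -(big_mkord (fun k => j < k)%N (fun k => F (k.-1 - j)%N j)).
  rewrite (big_cat_nat (n := (N - j.+1)%N)) ?leq_subr //=.
  rewrite [X in _ + X]big_nat_cond [X in _ + X]big1 => [|i]; last first.
    by rewrite andbT => /andP[h1 h2]; apply: F0; lia.
  rewrite addr0 [RHS](big_cat_nat (n := j.+1)) //=.
  rewrite [X in _ = X + _]big_nat_cond [X in _ = X + _]big1 => [|k]; last by lia.
  rewrite add0r -[X in index_iota X N]add0n big_addn.
  rewrite [RHS]big_nat_cond [LHS]big_nat_cond.
  apply: eq_big => [k|k _]; last by congr F; lia.
  by case: (_ <= k < _)%N => //=; lia.
rewrite exchange_big (eq_bigr _ (fun j _ => e1 j)) /=.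
rewrite (exchange_big_dep xpredT) //=; apply: eq_bigr => k _.
rewrite -(big_mkord (fun i => i < k)%N (fun i => F (k.-1 - i)%N i)).
rewrite -(big_mkord xpredT (fun i => F (k.-1 - i)%N i)).
rewrite [RHS](big_nat_widen _ _ N) //; exact: ltnW.
Qed.
End ReindexSum.

Section ChangeOfVariables.
Variables (K S : comNzRingType) (a : K) (n : nat) (X : 'I_n -> S).
Variables (d : 'I_n -> S -> S) (phi : {rmorphism psymfun K -> S}).
Hypothesis dD : forall u, {morph d u : p q / p + q}.
Hypothesis dM : forall u p q, d u (p * q) = d u p * q + p * d u q.
Hypothesis dX : forall u v, d u (X v) = (u == v)%:R.
Hypothesis dC : forall u (c : K), d u (phi c%:MP) = 0.
Hypothesis phiX : forall k, phi << ucm k >> = \sum_(u < n) X u ^+ k.+1.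
Variables (N : nat) (f : psymfun K).
Hypothesis fN : supported (fun m => psum_weight m <= N)%N f.

Let G k := phi (pderiv k f).
Let G2 j k := phi (pderiv j (pderiv k f)).

(* It is x_u x_v (d_u - d_v) / (x_u - x_v) applied to phi f; the form below
   avoids the division, see exchange_part_eq. *)
Definition exchange_part (u v : 'I_n) : S :=
  \sum_(k < N) (k.+1%:R * (X u * X v) * (\sum_(i < k) X u ^+ (k.-1 - i) * X v ^+ i)
    * phi (pderiv (k : nat) f)).

Lemma derivation0 u : d u 0 = 0.
Proof. by apply: (addIr (d u 0)); rewrite -dD !add0r. Qed.

Lemma derivation1 u : d u 1 = 0.
Proof. by have := dC u 1; rewrite rmorph1. Qed.

Lemma derivation_sum u (T : Type) (r : seq T) (F : T -> S) :
  d u (\sum_(t <- r) F t) = \sum_(t <- r) d u (F t).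
Proof. exact: (big_morph _ (dD u) (derivation0 u)). Qed.

Lemma derivationX u v k : d u (X v ^+ k) = (X v ^+ k.-1 *+ k) *+ (u == v).
Proof.
elim: k => [|k IH]; first by rewrite expr0 derivation1 mulr0n mul0rn.
rewrite exprS dM dX IH; case: eqP => _; last by rewrite !mulr0n mul0r mulr0 addr0.
rewrite !mulr1n mul1r mulrnAr mulrS; congr (_ + _).
by case: k {IH} => [|k]; rewrite ?mulr0n //= -exprS.
Qed.

Lemma derivation_psum u k : d u (phi << ucm k >>) = X u ^+ k *+ k.+1.
Proof.
rewrite phiX derivation_sum (bigD1 u) //= derivationX eqxx mulr1n /=.
rewrite big1 ?addr0 // => v vu.
by rewrite derivationX eq_sym (negbTE vu) mulr0n.
Qed.

Lemma supported_pderiv_le k :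
  supported (fun m => psum_weight m <= N)%N (pderiv k f).
Proof.
apply: supportedW (supported_pderiv (x := k) fN) => m.
by rewrite psum_weightM; lia.
Qed.

Lemma derivation_phi u : d u (phi f) = \sum_(k < N) G k * (X u ^+ k *+ k.+1).
Proof.
rewrite (chain_rule (dD u) (dM u) (dC u) fN); apply: eq_bigr => k _.
by rewrite derivation_psum.
Qed.

Lemma derivation_phi2 u : X u ^+ 2 * d u (d u (phi f)) =
  \sum_(i < N) (\sum_(j < N) (i.+1 * j.+1)%:R * X u ^+ (i + j).+2 * G2 i j
    + (i.+1 * i)%:R * X u ^+ i.+1 * G i).
Proof.
rewrite derivation_phi derivation_sum mulr_sumr big_split /=.
rewrite exchange_big -big_split /=; apply: eq_bigr => k _.
rewrite dM -mulr_natl dM.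
have -> : d u k.+1%:R = 0.
  by elim: (k.+1) => [|j IH]; rewrite ?derivation0 // mulrS dD IH derivation1 addr0.
rewrite mul0r add0r derivationX eqxx mulr1n mulrDr; congr (_ + _).
  rewrite /G (chain_rule (dD u) (dM u) (dC u) (@supported_pderiv_le k)).
  rewrite mulr_suml mulr_sumr; apply: eq_bigr => i _.
  rewrite -> derivation_psum; rewrite /G2; move: (phi _) => g.
  by rewrite -(mulr_natl (X u ^+ i)) natrM -(addn2 (i + k)) !exprD; ring.
case: (k : nat) => [|j]; first by rewrite muln0 mulr0n !mul0r !mulr0.
rewrite /G; move: (phi _) => g.
by rewrite /= -(mulr_natl (X u ^+ j)) natrM !exprS; ring.
Qed.

(** The inner sum of [exchange_part] is the quotient of [X u ^+ k - X v ^+ k] by [X u - X v]. *)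
Lemma exchange_part_eq u v :
  (X u - X v) * exchange_part u v = X u * X v * (d u (phi f) - d v (phi f)).
Proof.
rewrite !derivation_phi -sumrB !mulr_sumr; apply: eq_bigr => k _.
rewrite -/(G k) -mulrBr -mulrnBl subrXX -mulr_natl.
by move: (\sum_(i < k) _) => s; ring.
Qed.

(** The chain rule, applied twice, accounts for the terms with coefficient [a]. When the products of
    power sums are expanded over [u] and [v], the off-diagonal part is the exchange term, and the
    diagonal is cancelled by the [-1] in the coefficient [a - 1] of [jack_op]. *)
Lemma phi_jack_op : phi (jack_op a N f) =
  phi a%:MP * (\sum_(u < n) X u ^+ 2 * d u (d u (phi f)))
  + \sum_(u < n) \sum_(v < n | v != u) exchange_part u v.
Proof.
pose P k := \sum_(u < n) X u ^+ k.+1.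
have G0 k : (N <= k)%N -> G k = 0.
  move=> Nk; rewrite /G pderiv_eq0 ?rmorph0 //; apply: supportedW fN => m mN.
  by apply/eqP; rewrite -leqn0 leqNgt; apply/negP => /psum_weight_lt; lia.
have phiZ c g : phi (c *: g) = phi c%:MP * phi g.
  by rewrite -mul_malgC; exact: rmorphM.
have phi_nat (k : nat) : phi k%:R%:MP = k%:R by rewrite mpolyC_nat rmorph_nat.
have phiU k g : phi (<< ucm k >> * g) = P k * phi g.
  by rewrite -[P k]phiX; exact: rmorphM.
have phiT c (m k : nat) g : phi ((c * m%:R) *: (<< ucm k >> * g)) =
    phi c%:MP * (m%:R * P k * phi g).
  have e : phi (c * m%:R)%:MP = phi c%:MP * m%:R.
    by rewrite mpolyCM -phi_nat; exact: rmorphM.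
  by rewrite -> phiZ, phiU, e; rewrite !mulrA.
have phiT2 (m i j : nat) g : phi (m%:R *: (<< ucm i >> * (<< ucm j >> * g))) =
    m%:R * (P i * P j) * phi g.
  by rewrite -> phiZ, !phiU, phi_nat; rewrite !mulrA.
have phia1 : phi (a - 1)%:MP = phi a%:MP - 1.
  by rewrite monalgUB raddfB /=; congr (_ - _); exact: rmorph1.
(* Splits [a - 1]: the part in [a] goes with the second derivatives, the [-1] with the products
   [P i * P j]. *)
have -> : phi (jack_op a N f) =
    phi a%:MP * \sum_(i < N) (\sum_(j < N) (i.+1 * j.+1)%:R * P (i + j).+1 * G2 i j
      + (i.+1 * i)%:R * P i * G i)
    + (\sum_(i < N) \sum_(j < N) (i + j).+2%:R * (P i * P j) * G (i + j).+1
       - \sum_(i < N) (i.+1 * i)%:R * P i * G i).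
  rewrite big_split /= mulrDr.
  rewrite (_ : forall s t u v : S, s * t + s * u + (v - u) = s * t + v + (s - 1) * u).
    rewrite raddfD /=; congr (_ + _).
      rewrite raddf_sum mulr_sumr -big_split /=; apply: eq_bigr => i _.
      rewrite raddf_sum mulr_sumr -big_split /=; apply: eq_bigr => j _.
      by rewrite raddfD /=; apply: f_equal2; [exact: phiT|exact: phiT2].
    rewrite raddf_sum mulr_sumr /=; apply: eq_bigr => i _.
    by rewrite -phia1; exact: phiT.
  by move=> *; ring.
congr (phi _ * _ + _).
  rewrite (eq_bigr _ (fun u _ => derivation_phi2 u)) exchange_big /=.
  apply: eq_bigr => i _; rewrite big_split exchange_big /=; congr (_ + _).
    by apply: eq_bigr => j _; rewrite -mulr_suml -mulr_sumr.
  by rewrite -mulr_suml -mulr_sumr.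
rewrite (sum_by_total (N := N)
  (F := fun i j => (i + j).+2%:R * (P i * P j) * G (i + j).+1)); last first.
  by move=> i j /G0 ->; rewrite mulr0.
pose W u v k := (\sum_(i < k) X u ^+ (k.-1 - i) * X v ^+ i).
have -> : \sum_(u < n) \sum_(v < n | v != u) exchange_part u v =
   \sum_(k < N) k.+1%:R * (\sum_(u < n) \sum_(v < n | v != u)
     X u * X v * W u v k) * G k.
  rewrite /exchange_part; under eq_bigr => u _ do rewrite exchange_big.
  rewrite exchange_big; apply: eq_bigr => k _.
  rewrite mulr_sumr mulr_suml; apply: eq_bigr => u _.
  rewrite mulr_sumr mulr_suml; apply: eq_bigr => v _.
  by rewrite !mulrA.
rewrite -sumrB; apply: eq_bigr => k _.
have -> : (k.+1 * k)%:R * P k * G k = k.+1%:R * (k%:R * P k) * G k.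
  by rewrite natrM !mulrA.
have -> : \sum_(i < k) (k.-1 - i + i).+2%:R * (P (k.-1 - i)%N * P i) *
    G (k.-1 - i + i).+1 = k.+1%:R * (\sum_(i < k) P (k.-1 - i)%N * P i) * G k.
  rewrite mulr_sumr mulr_suml; apply: eq_bigr => i _.
  by have -> : (k.-1 - i + i).+1 = k by case: i => /= i; lia.
rewrite -mulrBl -mulrBr; congr (_ * _ * _).
apply/eqP; rewrite subr_eq addrC; apply/eqP.
(* The diagonal [u = v]: the [k] summands of [W u u k] all equal [X u ^+ k.-1]. *)
have -> : k%:R * P k = \sum_(u < n) X u * X u * W u u k.
  rewrite mulr_sumr; apply: eq_bigr => u _; rewrite /W mulr_natl.
  rewrite (eq_bigr (fun=> X u ^+ k.-1)) => [|i _]; last first.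
    by rewrite -exprD; congr (_ ^+ _); case: i => /= i; lia.
  rewrite sumr_const card_ord mulrnAr.
  by case: (k : nat) => [|j]; rewrite ?mulr0n // !exprS -mulrA.
rewrite -big_split /= (eq_bigr (fun i : 'I_k => \sum_(u < n) \sum_(v < n)
    X u * X v * (X u ^+ (k.-1 - i) * X v ^+ i))) => [|i _]; last first.
  rewrite /P mulr_suml; apply: eq_bigr => u _.
  rewrite mulr_sumr; apply: eq_bigr => v _.
  by rewrite !exprS mulrACA.
rewrite exchange_big; apply: eq_bigr => u _.
rewrite exchange_big (bigD1 u) //= /W; congr (_ + _); first by rewrite mulr_sumr.
by apply: eq_bigr => v _; rewrite mulr_sumr.
Qed.

End ChangeOfVariables.

(** * Restriction to finitely many variables *)

Lemma euler_homog (K : comNzRingType) (n N : nat) (f : psymfun K) :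
  (n <= N)%N -> psum_homog n f ->
  \sum_(k < N) k.+1%:R *: (<< ucm (k : nat) >> * pderiv (k : nat) f) = n%:R *: f.
Proof.
move=> nN hf; pose T (f : psymfun K) : psymfun K :=
  \sum_(k < N) k.+1%:R *: (<< ucm (k : nat) >> * pderiv (k : nat) f).
have TD : {morph T : f g / f + g}.
  move=> g h; rewrite /T -big_split; apply: eq_bigr => k _ /=.
  by rewrite pderivD mulrDr scalerDr.
rewrite -/(T f); apply: (malg_ind_supp (Q := fun g => T g = n%:R *: g)).
- by rewrite scaler0 /T big1 // => k _; rewrite pderiv0 mulr0 scaler0.
- by move=> g h Tg Th; rewrite TD Tg Th scalerDr.
move=> m /hf mn; move: (f@_m) => c.
have Zm d : n%:R *: << d *g m >> = << d *+ n *g m >> :> {malg K[{cmonom nat}]}.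
  by rewrite scaler_nat monalgUMn.
have -> : T << c *g m >> = \sum_(k < N) << c *+ (m k * k.+1) *g m >>.
  apply: eq_bigr => k _; rewrite -> pderivU, mul_monom.
  rewrite mul1r scaler_nat -monalgUMn mulrnA.
  have [->|mk] := posnP (m k); first by rewrite mulr0n mul0rn !monalgU0.
  by rewrite mulmC (mulcm_divcm mk).
rewrite Zm -raddf_sum sumrMnr -mn; congr << c *+ _ *g m >>.
rewrite /psum_weight -(big_mkord xpredT (fun k => m k * k.+1)%N).
rewrite (bigID (fun k => 0 < m k)%N) /= [X in (_ + X)%N]big1 => [|k]; last first.
  by rewrite -eqn0Ngt => /eqP ->.
rewrite addn0 -big_filter; apply: perm_big; apply: uniq_perm.
- by rewrite filter_uniq ?iota_uniq.
- exact: fset_uniq.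
move=> k; rewrite mem_filter msupp_cmonom mem_index_iota /=.
by apply: andb_idr => /psum_weight_lt; lia.
Qed.

Section Monomials.
Import mpoly.
Local Notation MP n K := (mpoly.mpoly n K).
Local Notation mcoeff := mpoly.mcoeff.
Variables (n : nat) (K : comNzRingType).
Implicit Types (p q : MP n K) (a : multinom n) (u v : 'I_n).

(* This statistic replaces the dominance order: it strictly increases along
   it, and it is visible on monomials without sorting their exponents. *)
Definition sumsq a : nat := (\sum_(u < n) a u ^ 2)%N.

Lemma mcoeffMXU u p a :
  mcoeff a ('X_u * p) =
  if a u == 0%N then 0 else mcoeff (mnm_sub a (mnm1 u)) p.
Proof.
rewrite -commr_mpolyX; case: eqP => [a0|/eqP au].
  rewrite {1}(mpolyE p) mulr_suml raddf_sum big1 // => m _ /=.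
  rewrite -scalerAl -mpolyXD mcoeffZ mcoeffX.
  case: eqP => [e|_]; last by rewrite mulr0.
  by move: a0; rewrite -e mnmDE mnm1E eqxx addn1.
rewrite -{1}[a](@submK _ (mnm1 u)); last first.
  by apply/mnm_lepP => v; rewrite mnm1E; case: eqP => // <-; rewrite lt0n.
by rewrite addmC mcoeffMX.
Qed.

Lemma mcoeff_euler u p a :
  mcoeff a ('X_u * mderiv u p) = mcoeff a p *+ a u.
Proof.
rewrite mcoeffMXU; case: eqP => [->|/eqP au]; first by rewrite mulr0n.
rewrite mcoeff_deriv mnmBE mnm1E eqxx subn1.
suff [-> ->] : (a - U_(u) + U_(u))%MM = a /\ (a u).-1.+1 = a u by [].
split; last by rewrite prednK // lt0n.
apply: submK; apply/mnm_lepP => v.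
by rewrite mnm1E; case: eqP => // <-; rewrite lt0n.
Qed.

Lemma mderivXU u v : mderiv u ('X_v : MP n K) = (u == v)%:R.
Proof.
rewrite mderivX mnm1E eq_sym; case: eqP => [->|_]; last by rewrite scale0r.
have -> : mnm_sub (mnm1 v) (mnm1 v) = mnm0.
  by apply/mnmP => i; rewrite mnmBE subnn mnm0E.
by rewrite scale1r mpolyX0.
Qed.

Lemma mcoeff_euler2 u p a :
  mcoeff a ('X_u ^+ 2 * mderiv u (mderiv u p)) =
  mcoeff a p *+ (a u * (a u).-1).
Proof.
have -> : 'X_u ^+ 2 * mderiv u (mderiv u p) =
   'X_u * mderiv u ('X_u * mderiv u p) - 'X_u * mderiv u p.
  by rewrite mderivM mderivXU eqxx mulrDr mul1r; ring.
rewrite mcoeffB !mcoeff_euler -mulrnA.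
case: (a u) => [|k]; first by rewrite !mulr0n subr0.
by rewrite -mulrnBr ?leq_pmulr //; congr (_ *+ _) => /=; lia.
Qed.

(** Moving a unit from the smaller exponent to the larger raises the sum of squares, and this stops
    when the smaller exponent is 0. By induction [q] vanishes at the shifted exponent, as [p] does,
    and only the term in [minn (a u) (a v)] remains. *)
Lemma mcoeff_exchange u v p q a : u != v ->
  ('X_u - 'X_v) * q = 'X_u * 'X_v * (mderiv u p - mderiv v p) ->
  (forall a', (sumsq a < sumsq a')%N -> mcoeff a' p = 0) ->
  mcoeff a q = - (mcoeff a p *+ minn (a u) (a v)).
Proof.
wlog le_uv : u v / (a u <= a v)%N => [IH|] uv eh p0.
  case/orP: (leq_total (a u) (a v)) => [le_uv|le_vu]; first exact: IH le_uv uv eh p0.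
  rewrite minnC; apply: (IH v u) => //; first by rewrite eq_sym.
  by rewrite -[LHS]opprK -mulNr opprB eh -mulrN opprB; ring.
rewrite (minn_idPl le_uv).
(* Comparing the coefficients of x^(a + e_v) expresses [q]_a through the
   coefficients at a - e_u + e_v, an exponent with a larger sum of squares. *)
have rec (b : multinom n) :
    (if b u == 0%N then 0 else mcoeff (b + U_(v) - U_(u))%MM q) - mcoeff b q =
    mcoeff b p *+ b u
    - (if b u == 0%N then 0 else mcoeff (b + U_(v) - U_(u))%MM p *+ (b v).+1).
  have bu : (b + U_(v))%MM u = b u by rewrite mnmDE mnm1E eq_sym (negbTE uv) addn0.
  have bK : (b + U_(v) - U_(v))%MM = b by rewrite addmK.
  have := congr1 (mcoeff (b + U_(v))%MM) eh.
  rewrite mulrBl mcoeffB !mcoeffMXU bu bK.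
  have -> : (b + U_(v))%MM v == 0%N = false by rewrite mnmDE mnm1E eqxx addn1.
  move=> ->.
  have -> : 'X_u * 'X_v * (mderiv u p - mderiv v p) =
    'X_v * ('X_u * mderiv u p) - 'X_u * ('X_v * mderiv v p) by ring.
  rewrite mcoeffB (mcoeffMXU v ('X_u * _)) (mcoeffMXU u ('X_v * _)) bu bK mcoeff_euler.
  have -> : (b + U_(v))%MM v == 0%N = false by rewrite mnmDE mnm1E eqxx addn1.
  rewrite mcoeff_euler; congr (_ - _); case: eqP => // _; congr (_ *+ _).
  by rewrite mnmBE mnmDE !mnm1E eqxx (negbTE uv) subn0 addn1.
move: {2}(a u) (erefl (a u)) => t; elim: t a le_uv p0 => [|t IH] a le_uv p0 au.
  have := rec a; rewrite au eqxx !mulr0n oppr0 !add0r => /eqP.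
  by rewrite oppr_eq0 => /eqP.
pose a' := (a + U_(v) - U_(u))%MM.
have a'u : a' u = t.
  by rewrite mnmBE mnmDE !mnm1E eqxx eq_sym (negbTE uv) addn0 au subn1.
have a'v : a' v = (a v).+1.
  by rewrite mnmBE mnmDE !mnm1E eqxx (negbTE uv) subn0 addn1.
(* As [a u <= a v], the sum of squares grows by [2 (a v - a u) + 2]. *)
have lt_sq : (sumsq a < sumsq a')%N.
  rewrite /sumsq (bigD1 u) // (bigD1 v) 1?eq_sym //=.
  rewrite [X in (_ < X)%N](bigD1 u) // [X in (_ < _ + X)%N](bigD1 v) 1?eq_sym //=.
  rewrite a'u a'v au (eq_bigr (fun i => a' i ^ 2)%N) => [|i /andP[iu iv]].
    by move: le_uv; rewrite au !addnA ltn_add2r -!mulnn; nia.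
  by rewrite mnmBE mnmDE !mnm1E ![_ == i]eq_sym (negbTE iu) (negbTE iv) addn0 subn0.
have p'0 : mcoeff a' p = 0 by exact: p0.
have h'0 : mcoeff a' q = 0.
  rewrite IH ?p'0 ?mul0rn ?oppr0 //; first by rewrite a'u a'v; lia.
  by move=> b /(ltn_trans lt_sq)/p0.
have := rec a; rewrite au /= -/a' p'0 h'0 mul0rn sub0r subr0 => <-.
by rewrite opprK.
Qed.

End Monomials.

Lemma polyrat_mulrn_eq0 (c : {poly rat}) k : (c *+ k == 0) = (k == 0%N) || (c == 0).
Proof. by rewrite -scaler_nat scaler_eq0 pnatr_eq0. Qed.

Lemma pderiv_all0 (f : psymfun {poly rat}) :
  (forall k, pderiv k f = 0) -> f = (f@_mone)%:MP.
Proof.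
move=> f0; apply/malgP => m; rewrite mcoeffC.
have [->|m1] := eqVneq m mone; first by rewrite mulr1n.
elim/(@cmonom_ind nat): m m1 => [|k m _ _]; first by rewrite eqxx.
have := mcoeff_pderiv k f m; rewrite f0 mcoeff0 mulr0n => /esym/eqP.
by rewrite polyrat_mulrn_eq0 /= => /eqP.
Qed.

Module InVariables.
Section Variables.
Import perm mpoly.
Local Notation MP n K := (mpoly.mpoly n K).
Local Notation mcoeff := mpoly.mcoeff.
Local Notation mdeg := mpoly.mdeg.
Variable n : nat.

Section CommutativeRing.
Variable K : comNzRingType.
Implicit Types (a : multinom n) (u v : 'I_n) (f : psymfun K).

Definition psum_vars (f : psymfun K) : MP n K :=
  psum_eval (@mpolyC n K) (fun k => \sum_(i < n) 'X_i ^+ k) f.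

HB.instance Definition _ := GRing.RMorphism.copy psum_vars
  (psum_eval (@mpolyC n K) (fun k => \sum_(i < n) 'X_i ^+ k)).

Lemma psum_varsU k : psum_vars << ucm k >> = \sum_(i < n) 'X_i ^+ k.+1.
Proof. exact: psum_evalU. Qed.

Lemma psum_varsC (c : K) : psum_vars (monalg.mkmalgU mone c) = mpolyC n c.
Proof. exact: psum_evalC. Qed.

Lemma mderiv_psum_varsC u (c : K) :
  mderiv u (psum_vars (monalg.mkmalgU mone c)) = 0.
Proof. by rewrite psum_varsC mderivC. Qed.

Let phi : {rmorphism psymfun K -> MP n K} := psum_vars.
Let X u : MP n K := 'X_u.

Lemma mderiv_psum_vars N f u : supported (fun m => psum_weight m <= N)%N f ->
  mderiv u (psum_vars f) =
  \sum_(k < N) psum_vars (pderiv (k : nat) f) * ('X_u ^+ k *+ k.+1).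
Proof.
move=> fN; exact: (@derivation_phi K (MP n K) n X (@mderiv n K) phi
  (@mderivD n K) (@mderivM n K) (@mderivXU n K) mderiv_psum_varsC psum_varsU).
Qed.

(** On a partition this is [2 (t n(la') - n(la))], where [la'] is the conjugate and [n(la)] the sum
    of the [(i - 1) la_i]; see [sum_minn_part]. The form with [minn] is symmetric in the exponents
    and needs no sorting. *)
Definition jack_eigenvalue (t : K) a : K :=
  t * (\sum_u a u * (a u).-1)%N%:R -
  (\sum_u \sum_(v | v != u) minn (a u) (a v))%N%:R.

(** The second-order part is diagonal on monomials, and each ordered pair [(u, v)] contributes the
    scalar of [mcoeff_exchange], since nothing lies above [a]. *)
Lemma mcoeff_jack_op (t : K) N f a :
  supported (fun m => psum_weight m <= N)%N f ->
  (forall a', (sumsq a < sumsq a')%N -> mcoeff a' (psum_vars f) = 0) ->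
  mcoeff a (psum_vars (jack_op t N f)) =
  jack_eigenvalue t a * mcoeff a (psum_vars f).
Proof.
move=> fN f0.
have := @phi_jack_op K (MP n K) t n X (@mderiv n K) phi (@mderivD n K)
  (@mderivM n K) (@mderivXU n K) mderiv_psum_varsC psum_varsU N f fN.
rewrite /phi /= => ->; rewrite mcoeffD psum_varsC mcoeffCM mulrBl; congr (_ + _).
  rewrite raddf_sum -mulrA; congr (_ * _).
  rewrite natr_sum mulr_suml; apply: eq_bigr => u _ /=.
  by rewrite mcoeff_euler2 mulr_natl.
rewrite raddf_sum natr_sum mulr_suml -sumrN; apply: eq_bigr => u _ /=.
rewrite raddf_sum natr_sum mulr_suml -sumrN; apply: eq_bigr => v vu /=.
rewrite mulr_natl; apply: mcoeff_exchange => //; first by rewrite eq_sym.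
exact: (@exchange_part_eq K (MP n K) n X (@mderiv n K) phi (@mderivD n K)
  (@mderivM n K) (@mderivXU n K) mderiv_psum_varsC psum_varsU N f fN).
Qed.

Lemma psum_vars_sym f : psum_vars f \is symmetric.
Proof.
rewrite /psum_vars /psum_eval /monalg.mmap; apply: rpred_sum => m _.
apply: rpredM.
  by rewrite -[mpolyC _ _]mulr1 mul_mpolyC; apply: rpredZ; exact: rpred1.
apply: rpred_prod => k _; apply: rpredX.
apply/issymP => s; rewrite raddf_sum [RHS](reindex_inj (@perm_inj _ s)) /=.
apply: eq_bigr => i _; rewrite rmorphXn /=; congr (_ ^+ _).
rewrite msymX; congr mpolyX; apply/mnmP => j.
by rewrite mnmE !mnm1E -(inj_eq (@perm_inj _ s)) permKV.
Qed.

Lemma mcoeff_psum_vars_perm f a (s : 'S_n) :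
  mcoeff [multinom a (s i) | i < n] (psum_vars f) = mcoeff a (psum_vars f).
Proof. by rewrite -mcoeff_sym (issymP _ (psum_vars_sym f) s). Qed.

End CommutativeRing.

Implicit Types f : psymfun {poly rat}.

Lemma mpoly_mulrn_eq0 (p : MP n {poly rat}) k : p *+ k.+1 = 0 -> p = 0.
Proof.
move=> /mpolyP p0; apply/mpolyP => a; apply/eqP; move/eqP: (p0 a).
by rewrite mcoeffMn !mcoeff0 polyrat_mulrn_eq0.
Qed.

(* The derivatives of psum_vars f are Vandermonde combinations of the
   psum_vars (d f / d p_k). *)
Lemma psum_vars_eq0 f : supported (fun m => psum_weight m <= n)%N f ->
  psum_vars f = 0 -> f = 0.
Proof.
have const (g : psymfun {poly rat}) :
    psum_vars g = 0 -> (forall k, pderiv k g = 0) -> g = 0.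
  move=> g0 /pderiv_all0 e; move: g0; rewrite e psum_varsC => /eqP.
  by rewrite mpolyC_eq0 => /eqP ->; rewrite monalgU0.
suff H M (g : psymfun {poly rat}) : (M <= n)%N ->
    supported (fun m => psum_weight m <= M)%N g ->
    psum_vars g = 0 -> g = 0 by exact: H.
(* The bound [M] on the weight decreases under differentiation while the number [n] of variables
   stays fixed. *)
elim: M g => [|M IH] g Mn gM g0; apply: const => // k.
  apply: pderiv_eq0; apply: supportedW gM => m m0.
  by apply/eqP; rewrite -leqn0 leqNgt; apply/negP => /psum_weight_lt; lia.
have gn : supported (fun m => psum_weight m <= n)%N g.
  by apply: supportedW gM => m /leq_trans; apply.
have [kn|nk] := ltnP k n; last first.
  apply: pderiv_eq0; apply: supportedW gn => m mn.
  by apply/eqP; rewrite -leqn0 leqNgt; apply/negP => /psum_weight_lt; lia.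
apply: IH; first exact: ltnW.
  apply: supportedW (supported_pderiv (x := k) gM) => m.
  by rewrite psum_weightM psum_weightU; lia.
pose w : 'rV[MP n {poly rat}]_n :=
  \row_(j < n) (psum_vars (pderiv (j : nat) g) *+ j.+1).
pose V : 'M[MP n {poly rat}]_n := Vandermonde n (\row_(u < n) 'X_u).
have wV : w *m V = 0.
  apply/rowP => u; rewrite !mxE.
  have := mderiv_psum_vars u gn; rewrite g0 linear0 => e; rewrite [RHS]e.
  apply: eq_bigr => j _.
  by rewrite !mxE mulrnAl mulrnAr.
have detV : \det V != 0.
  rewrite det_Vandermonde; apply/prodf_neq0 => i _; apply/prodf_neq0 => j ij.
  rewrite !mxE subr_eq0; apply/eqP => /(congr1 (mcoeff U_(i))).
  rewrite !mcoeffXU eqxx => /eqP.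
  have -> : (j == i) = false by apply/eqP => e; rewrite e ltnn in ij.
  by rewrite eq_sym oner_eq0.
(* The adjugate stands in for an inverse over the polynomial ring; the nonzero factor [\det V] is
   cancelled afterwards. *)
have : \det V *: w = 0.
  by rewrite -mul_mx_scalar -mul_mx_adj mulmxA wV mul0mx.
move/rowP/(_ (Ordinal kn)); rewrite !mxE => /eqP.
by rewrite mulf_eq0 (negbTE detV) /= => /eqP /mpoly_mulrn_eq0.
Qed.

(** Euler's operator in the [x_u] corresponds to Euler's operator in the power sums, which
    multiplies [f] by [d]; the coefficients at [a] are then compared in characteristic zero. *)
Lemma psum_vars_mdeg d f (a : multinom n) : (d <= n)%N -> psum_homog d f ->
  mcoeff a (psum_vars f) != 0 -> mdeg a = d.
Proof.
move=> dn hf nz.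
have fn : supported (fun m => psum_weight m <= n)%N f.
  by apply: supportedW hf => m ->.
have e : \sum_u 'X_u * mderiv u (psum_vars f) = d%:R * psum_vars f.
  have -> : d%:R * psum_vars f = psum_vars (d%:R *: f).
    rewrite [RHS]psum_evalZ; congr (_ * _).
    by rewrite rmorph_nat.
  rewrite -(euler_homog dn hf) raddf_sum /=.
  under eq_bigr => u _ do rewrite (mderiv_psum_vars u fn) mulr_sumr.
  rewrite exchange_big; apply: eq_bigr => k _ /=.
  rewrite [RHS]psum_evalZ rmorph_nat.
  have -> : psum_eval (@mpolyC n {poly rat}) (fun k => \sum_(i < n) 'X_i ^+ k)
      (<< ucm (k : nat) >> * pderiv (k : nat) f) =
      psum_vars << ucm (k : nat) >> * psum_vars (pderiv (k : nat) f).
    pose phi : {rmorphism psymfun {poly rat} -> MP n {poly rat}} :=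
      @psum_vars {poly rat}.
    exact: (rmorphM phi).
  rewrite psum_varsU mulr_suml mulr_sumr; apply: eq_bigr => u _.
  by rewrite exprS -mulr_natl; ring.
have := congr1 (mcoeff a) e; rewrite raddf_sum /= mulr_natl mcoeffMn.
under eq_bigr => u _ do rewrite mcoeff_euler.
rewrite sumrMnr -mdegE => /eqP; have [ad|ad] := leqP d (mdeg a).
  rewrite -(subnK ad) mulrnDr -subr_eq0 addrK polyrat_mulrn_eq0 (negbTE nz) orbF.
  by move=> /eqP ->.
rewrite -(subnK (ltnW ad)) mulrnDr eq_sym -subr_eq0 addrK polyrat_mulrn_eq0.
by rewrite (negbTE nz) orbF => /eqP ->.
Qed.

End Variables.
End InVariables.
Import InVariables.

(** * Partitions as exponent vectors *)

Section Partitions.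
Import perm mpoly.
Local Notation mcoeff := mpoly.mcoeff.
Local Notation mdeg := mpoly.mdeg.
Variable n : nat.
Implicit Types (mu nu la : seq nat) (a : multinom n).

Definition part_mnm mu : multinom n := [multinom nth 0%N mu i | i < n].

Definition partition_of mu : bool := is_partition mu && (sumn mu == n).

Lemma is_partition_size mu : is_partition mu -> (size mu <= sumn mu)%N.
Proof.
move=> /andP[_]; elim: mu => //= x mu IH; rewrite inE negb_or => /andP[x0 mu0].
by rewrite -add1n leq_add ?IH // lt0n eq_sym.
Qed.

Lemma sumn_nth mu k : sumn (take k mu) = (\sum_(i < k) nth 0 mu i)%N.
Proof.
elim: k mu => [|k IH] [|x mu]; rewrite ?big_ord0 //=.
  by rewrite big1 // => i _; rewrite nth_nil.
by rewrite big_ord_recl /= IH.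
Qed.

Lemma is_partition_nth mu i j : is_partition mu -> (i <= j)%N ->
  (nth 0 mu j <= nth 0 mu i)%N.
Proof.
move=> /andP[smu _] ij; have [jm|jm] := ltnP j (size mu); last by rewrite nth_default.
have := @sorted_leq_nth _ geq _ _ 0%N mu smu i j.
apply => //; rewrite ?inE //; [|by move=> ?; exact: leqnn|exact: leq_ltn_trans jm].
by move=> x y z /= xy zx; exact: leq_trans xy.
Qed.

Lemma is_partition_nth_gt0 mu i : is_partition mu ->
  (0 < nth 0 mu i)%N = (i < size mu)%N.
Proof.
move=> /andP[_ mu0]; have [im|im] := ltnP i (size mu); last by rewrite nth_default.
by rewrite lt0n; apply: contraNneq mu0 => <-; rewrite mem_nth.
Qed.

Lemma part_mnm_inj mu la : partition_of mu -> partition_of la ->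
  (forall i, (i < n)%N -> nth 0%N mu i = nth 0%N la i) -> mu = la.
Proof.
move=> /andP[pm /eqP sm] /andP[pl /eqP sl] e.
have e' i : nth 0%N mu i = nth 0%N la i.
  have [/e //|ni] := ltnP i n.
  by rewrite !nth_default //; [rewrite -sl in ni|rewrite -sm in ni];
    apply: leq_trans (is_partition_size _) ni.
have sz mu' la' : is_partition mu' -> is_partition la' ->
    (forall i, nth 0%N mu' i = nth 0%N la' i) -> (size mu' <= size la')%N.
  move=> p q eq; rewrite leqNgt -is_partition_nth_gt0 // eq.
  by rewrite is_partition_nth_gt0 // ltnn.
by apply: (@eq_from_nth _ 0%N) => //; apply/eqP; rewrite eqn_leq !sz.
Qed.

(** Write [y^2 - x^2 = (y - x)^2 + 2 x (y - x)] and sum by parts: as [x] is nonincreasing and the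
    partial sums of [y] dominate those of [x], the cross terms add up to something nonnegative. *)
Lemma dominated_sumsq mu la : partition_of mu -> partition_of la ->
  dominated mu la -> mu != la -> (sumsq (part_mnm mu) < sumsq (part_mnm la))%N.
Proof.
move=> pm pl [_ dom] ne; pose x i := nth 0%N mu i; pose y i := nth 0%N la i.
(* With truncated subtraction one of the two squares is 0, so [d i] is the square of the
   difference. *)
pose d i := ((x i - y i) ^ 2 + (y i - x i) ^ 2)%N.
have XY k : (\sum_(i < k) x i <= \sum_(i < k) y i)%N by rewrite -!sumn_nth.
have xS k : (x k.+1 <= x k)%N.
  by apply: is_partition_nth => //; case/andP: pm.
(* The middle term is the boundary term of the summation by parts; it carries the induction. *)
have key k : (\sum_(i < k) x i ^ 2
     + 2 * x k * (\sum_(i < k) y i - \sum_(i < k) x i) + \sum_(i < k) d i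
   <= \sum_(i < k) y i ^ 2)%N.
  elim: k => [|k IH]; first by rewrite !big_ord0 muln0.
  have := XY k; have := XY k.+1; move: IH (xS k); rewrite !big_ord_recr /= /d.
  move: (\sum_(i < k) x i)%N (\sum_(i < k) y i)%N (\sum_(i < k) x i ^ 2)%N
    (\sum_(i < k) y i ^ 2)%N (\sum_(i < k) _)%N (x k) (y k) (x k.+1).
  move=> X Y X2 Y2 D xk yk xk1 IH le_x le1 le2.
  have [Z eZ] : exists Z, Y = (X + Z)%N by exists (Y - X)%N; lia.
  have : (xk1 * (Y + yk - (X + xk)) <= xk * (Y + yk - (X + xk)))%N.
    by rewrite leq_mul2r le_x orbT.
  move: IH; rewrite eZ addKn -!mulnn.
  have [le_yx|lt_xy] := leqP yk xk.
    have [w ew] : exists w, xk = (yk + w)%N by exists (xk - yk)%N; lia.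
    have [v ev] : exists v, Z = (w + v)%N by exists (Z - w)%N; lia.
    rewrite ew ev (_ : X + (w + v) + yk - (X + (yk + w)) = v)%N; last by lia.
    rewrite addKn (_ : yk - (yk + w) = 0)%N; last by lia.
    nia.
  have [w ew] : exists w, yk = (xk + w)%N by exists (yk - xk)%N; lia.
  rewrite ew (_ : X + Z + (xk + w) - (X + xk) = Z + w)%N; last by lia.
  rewrite addKn (_ : xk - (xk + w) = 0)%N; last by lia.
  nia.
have [i ii xy] : exists2 i, (i < n)%N & x i != y i.
  apply/not_exists2P => h; case/eqP: ne; apply: part_mnm_inj => // i ni.
  by have [/(_ ni)//|/negP] := h i; rewrite negbK => /eqP.
rewrite /sumsq; under eq_bigr => j _ do rewrite mnmE -/(x j).
under [X in (_ < X)%N]eq_bigr => j _ do rewrite mnmE -/(y j).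
apply: leq_trans (key n).
rewrite -addnA -[X in (X < _)%N]addn0 ltn_add2l addn_gt0; apply/orP; right.
rewrite (bigD1 (Ordinal ii)) //= addn_gt0 /d addn_gt0 !expn_gt0 !orbF !subn_gt0.
by apply/orP; left; rewrite orbC -neq_ltn; exact: xy.
Qed.

Definition mnm_part a : seq nat := [seq x <- sort geq a | 0 < x]%N.

(** The zeros come last, and once they are removed [nth] returns the default 0 in their place. *)
Lemma nth_filter_gt0 s i : sorted geq s ->
  nth 0%N [seq x <- s | 0 < x]%N i = nth 0%N s i.
Proof.
elim: s i => //= x s IH i sx; have ss := path_sorted sx.
case: ltnP => [_|x0]; first by case: i => //= i; exact: IH.
have {x0}x0 : x = 0%N by lia.
have s0 : all (pred1 0%N) s.
  apply/allP => y ys /=; move: sx; rewrite x0 (path_sortedE (leT := geq)); last first.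
    by move=> u v w /= uv wu; exact: leq_trans uv.
  by move=> /andP[/allP/(_ y ys)]; rewrite /= leqn0.
rewrite (_ : [seq x <- s | 0 < x]%N = [::]); last first.
  apply/eqP; rewrite -size_eq0 size_filter -leqn0 leqNgt -has_count.
  by apply/hasPn => y /(allP s0)/= /eqP ->.
rewrite nth_nil; case: i => [|i] /=; first by rewrite x0.
have [ii|ii] := ltnP i (size s); last by rewrite nth_default.
by apply/esym/eqP; exact: (allP s0 _ (mem_nth 0%N ii)).
Qed.

Lemma geq_total : total geq.
Proof. by move=> x y; exact: leq_total. Qed.

Lemma mnm_part_perm a : exists s : 'S_n,
  part_mnm (mnm_part a) = [multinom a (s i) | i < n].
Proof.
have : perm_eq (sort_tuple geq a) a by rewrite perm_sort.
move/tuple_permP => [s es]; exists s; apply/mnmP => i.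
rewrite !mnmE nth_filter_gt0; last exact: (sort_sorted geq_total).
have -> : nth 0%N (sort geq a) i = nth 0%N (sort_tuple geq a) i by [].
by rewrite es (nth_map i) ?size_enum_ord // nth_ord_enum.
Qed.

Lemma mnm_partP a : mdeg a = n -> partition_of (mnm_part a).
Proof.
move=> an; apply/andP; split; last first.
  rewrite -[X in _ == X]an /mnm_part sumnE big_filter; apply/eqP.
  rewrite (perm_big _ (permEl (perm_sort geq a))) /=.
  rewrite mdegE -(big_tuple _ _ a predT id) /=.
  rewrite [RHS](bigID (fun x => 0 < x)%N) /= [X in (_ + X)%N]big1 ?addn0 // => x.
  by rewrite -eqn0Ngt => /eqP.
rewrite /is_partition mem_filter ltnn andbT.
apply: sorted_filter (sort_sorted geq_total _) => x y z /= xy zx.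
exact: leq_trans xy.
Qed.

Lemma sumsq_perm a (s : 'S_n) : sumsq [multinom a (s i) | i < n] = sumsq a.
Proof.
rewrite /sumsq [RHS](reindex_inj (@perm_inj _ s)).
by apply: eq_bigr => i _; rewrite mnmE.
Qed.

Lemma partitions_finite : exists L : seq (seq nat),
  forall mu, partition_of mu -> mu \in L.
Proof.
exists [seq [seq val i | i <- (t : seq 'I_n.+1)] | t : n.-bseq 'I_n.+1].
move=> mu /andP[pm /eqP sm].
have sz : (size [seq (inord x : 'I_n.+1) | x <- mu] <= n)%N.
  by rewrite size_map -[X in (_ <= X)%N]sm is_partition_size.
apply/mapP; exists (Bseq sz); first by rewrite mem_enum.
rewrite /= -map_comp map_id_in // => x xm /=; rewrite inordK // ltnS -sm.
by rewrite (perm_sumn (perm_to_rem xm)) /= leq_addr.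
Qed.

(** The smaller of two parts is the one of larger index, and [i] is the larger index in [2 * i]
    ordered pairs. *)
Lemma sum_minn_part la : partition_of la ->
  (\sum_u \sum_(v | v != u) minn (part_mnm la u) (part_mnm la v) =
   2 * \sum_(i < n) i * nth 0 la i)%N.
Proof.
move=> /andP[pl _]; pose y i := nth 0%N la i.
have e (u v : 'I_n) : minn (part_mnm la u) (part_mnm la v) = y (maxn u v).
  rewrite !mnmE; have [uv|vu] := leqP u v.
    by rewrite (minn_idPr (is_partition_nth pl uv)).
  by rewrite (minn_idPl (is_partition_nth pl (ltnW vu))).
under eq_bigr => u _ do (under eq_bigr => v _ do rewrite e).
rewrite (eq_bigr (fun u : 'I_n => \sum_(v < n | (v < u)%N) y u +
  \sum_(v < n | (u < v)%N) y v)%N) => [|u _].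
  rewrite big_split /= [X in (_ + X)%N](exchange_big_dep xpredT) //= addnn -mul2n.
  congr (2 * _)%N; apply: eq_bigr => u _.
  rewrite sum_nat_const; congr (_ * _)%N.
  rewrite -sum1_card -(big_mkord (fun v => v < u)%N (fun=> 1%N)).
  rewrite -(big_nat_widen _ _ _ xpredT) ?(ltnW (ltn_ord u)) //.
  by rewrite sum_nat_const_nat subn0 muln1.
rewrite (bigID (fun v : 'I_n => (v < u)%N)) /=; congr (_ + _)%N.
  apply: eq_big => [v|v /andP[_ vu]]; last by rewrite (maxn_idPl (ltnW vu)).
  by rewrite -val_eqE /=; case: ltngtP.
apply: eq_big => [v|v]; first by rewrite -val_eqE /=; case: ltngtP.
by rewrite -val_eqE /= -leqNgt => /andP[_ uv]; rewrite (maxn_idPr uv).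
Qed.

End Partitions.

(** * Jack functions as eigenfunctions *)

Section JackEigenfunctions.
Import mpoly.
Variable J : seq nat -> psymfun {poly rat}.
Hypothesis jackJ : jack_family J.
Variable n : nat.
Implicit Types (f g : psymfun {poly rat}) (mu nu la : seq nat).

Local Notation part := (partition_of n).
Local Notation coef mu f := (monomial_coeff n mu f).
Local Notation norm2 mu := (sumsq (part_mnm n mu)).

Lemma monomial_coeffE mu f :
  coef mu f = mpoly.mcoeff (part_mnm n mu) (psum_vars n f).
Proof. by []. Qed.

Lemma monomial_coeff_lin mu c d f g :
  coef mu (c *: f - d *: g) = c * coef mu f - d * coef mu g.
Proof.
pose phi : {rmorphism psymfun {poly rat} -> mpoly.mpoly n {poly rat}} :=
  psum_vars n (K := {poly rat}).
have Z e h : mpoly.mcoeff (part_mnm n mu) (phi (e *: h)) = e * coef mu h.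
  by rewrite [phi _]psum_evalZ mpoly.mcoeffCM.
by rewrite -!Z monomial_coeffE -mpoly.mcoeffB -(raddfB phi).
Qed.

Lemma psum_homog_jack la : part la -> psum_homog n (J la).
Proof.
move=> /andP[pl /eqP sl] m ml; rewrite -sl; exact: (jack_homogeneous jackJ).
Qed.

Lemma jack_coeff_lt la mu : part la -> part mu -> mu != la ->
  coef mu (J la) != 0 -> (norm2 mu < norm2 la)%N.
Proof.
move=> pl pm ne nz; apply: dominated_sumsq => //.
move: pl pm => /andP[pl /eqP sl] /andP[pm /eqP sm].
by apply: (jack_triangular jackJ) => //; rewrite sl.
Qed.

Lemma jack_neq0 la : part la -> J la != 0.
Proof.
move=> /andP[pl /eqP sl]; apply/eqP => J0.
have := jack_normalized jackJ pl; rewrite J0 sl monomial_coeffE.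
rewrite [psum_vars _ _](raddf0 (psum_vars n (K := {poly rat}))) mpoly.mcoeff0.
move/esym/eqP; rewrite -scaler_nat scaler_eq0 pnatr_eq0 oner_eq0 orbF.
by rewrite eqn0Ngt fact_gt0.
Qed.

Lemma mcoeff_part f a : psum_homog n f ->
  mpoly.mcoeff a (psum_vars n f) != 0 ->
  exists mu, [/\ part mu, norm2 mu = sumsq a &
    coef mu f = mpoly.mcoeff a (psum_vars n f)].
Proof.
move=> hf nz; have an := psum_vars_mdeg (leqnn n) hf nz.
exists (mnm_part a); have [s e] := mnm_part_perm a.
rewrite monomial_coeffE e sumsq_perm mcoeff_psum_vars_perm; split=> //.
exact: mnm_partP.
Qed.

Lemma coeff_all0 f : psum_homog n f -> (forall mu, part mu -> coef mu f = 0) ->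
  f = 0.
Proof.
move=> hf f0; apply: (@psum_vars_eq0 n).
  by apply: supportedW hf => m ->.
apply/mpoly.mpolyP => a; rewrite mpoly.mcoeff0; apply/eqP/negPn/negP => nz.
by have [mu [/f0 e _ e']] := mcoeff_part hf nz; rewrite -e' e eqxx in nz.
Qed.

Lemma psum_homog_comb c d f g : psum_homog n f -> psum_homog n g ->
  psum_homog n (c *: f - d *: g).
Proof. by move=> hf hg; apply: supportedB; apply: supportedZ. Qed.

Lemma lincomb_neq0 (R : comNzRingType) (c d x y : R) :
  c * x - d * y != 0 -> (x != 0) || (y != 0).
Proof.
apply: contraNT; rewrite negb_or !negbK => /andP[/eqP -> /eqP ->].
by rewrite !mulr0 subrr.
Qed.

(* Removes the coefficients of f at the partitions of a given norm one by one,
   subtracting multiples of Jack functions. *)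
Lemma jack_perp_aux k : 
  (forall f la, psum_homog n f ->
     (forall mu, part mu -> coef mu f != 0 -> (norm2 mu < k)%N) ->
     part la -> (k <= norm2 la)%N -> jack_scalar f (J la) = 0) ->
  forall (L : seq (seq nat)) f la, psum_homog n f ->
    (forall mu, mu \in L -> part mu /\ norm2 mu = k) ->
    (forall mu, part mu -> coef mu f != 0 -> (norm2 mu < k)%N \/ mu \in L) ->
    part la -> (k <= norm2 la)%N -> la \notin L -> jack_scalar f (J la) = 0.
Proof.
move=> base; elim=> [|mu L IH] f la hf hL fL pl kl laL.
  by apply: base => // nu pn /(fL _ pn)[].
have [pm km] : part mu /\ norm2 mu = k by apply: hL; rewrite inE eqxx.
move: laL; rewrite inE negb_or => /andP[lamu laL].
have hJ := psum_homog_jack pm.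
have Jlt nu : part nu -> nu != mu -> coef nu (J mu) != 0 -> (norm2 nu < k)%N.
  by move=> pn ne /(jack_coeff_lt pm pn ne); rewrite km.
have [c ec] : exists c, c = coef mu (J mu) := ex_intro _ _ (erefl _).
have [d ed] : exists d, d = coef mu f := ex_intro _ _ (erefl _).
(* Otherwise all coefficients of [J mu] would lie below [k], and [base] would make [J mu] orthogonal
   to itself. *)
have c0 : c != 0.
  apply: contraNneq (jack_neq0 pm) => c0; apply/eqP/jack_scalar_eq0.
  apply: (base _ _ hJ _ pm); last by rewrite km.
  move=> nu pn nz; apply: Jlt => //.
  by apply: contraNneq nz => ->; rewrite -ec c0.
(* This combination has no coefficient at [mu], and is formed without dividing in [{poly rat}]. *)
have hf' : psum_homog n (c *: f - d *: J mu) by exact: psum_homog_comb.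
have : jack_scalar (c *: f - d *: J mu) (J la) = 0.
  refine (IH _ _ hf' _ _ pl kl laL).
    by move=> nu nL; apply: hL; rewrite inE nL orbT.
  move=> nu pn nz.
  have /orP[/(fL _ pn)|nzJ] : (coef nu f != 0) || (coef nu (J mu) != 0).
  - by apply: (lincomb_neq0 (c := c) (d := d)); rewrite -> monomial_coeff_lin in nz.
  - rewrite inE => -[|/orP[/eqP enu|]]; [by left| |by right].
    by case/eqP: nz; rewrite enu monomial_coeff_lin -{}ec -{}ed mulrC subrr.
  left; apply: Jlt => //; apply: contraNneq nz => ->.
  by rewrite monomial_coeff_lin -{}ec -{}ed mulrC subrr.
have -> : jack_scalar (c *: f - d *: J mu) (J la) =
    c * jack_scalar f (J la) - d * jack_scalar (J mu) (J la).
  apply: etrans (psum_scalarBl _ _ _ _) _.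
  by apply: f_equal2; [|congr (- _)]; exact: psum_scalarZl.
have -> : jack_scalar (J mu) (J la) = 0.
  apply: (jack_orthogonal jackJ); last by rewrite eq_sym.
  - by case/andP: pm.
  - by case/andP: pl.
by move/eqP; rewrite mulr0 subr0 mulf_eq0 (negbTE c0) => /eqP.
Qed.

(** The induction clears one value of the norm at a time; the norm of [la] is larger, so only Jack
    functions other than [J la], hence orthogonal to it, are subtracted. *)
Lemma jack_perp k f la : psum_homog n f ->
  (forall mu, part mu -> coef mu f != 0 -> (norm2 mu < k)%N) ->
  part la -> (k <= norm2 la)%N -> jack_scalar f (J la) = 0.
Proof.
elim: k f la => [|k IH] f la hf fk pl kl.
  have -> : f = 0; last exact: psum_scalar0l.
  apply: coeff_all0 => // mu pm; apply/eqP/negPn/negP => nz.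
  by have := fk _ pm nz.
have [L0 L0P] := partitions_finite n.
pose L := [seq mu <- L0 | part mu & norm2 mu == k].
refine (@jack_perp_aux k IH L f la hf _ _ pl (ltnW kl) _).
- by move=> mu; rewrite mem_filter => /andP[/andP[pm /eqP ->]].
- move=> mu pm nz; have := fk _ pm nz; rewrite ltnS leq_eqVlt => /orP[e|]; last by left.
  by right; rewrite mem_filter pm e L0P.
- by rewrite mem_filter; apply/negP => /andP[/andP[_ /eqP e]]; rewrite e ltnn in kl.
Qed.

(** At norms not below that of [la], only the coefficient at [la] can survive in [f], and there
    [jack_op] acts by the subtracted scalar. Applied to [J la], then to the resulting [g]. *)
Lemma jack_op_lower N la f : (n <= N)%N -> part la -> psum_homog n f ->
  (forall mu, part mu -> coef mu f != 0 ->
     mu != la -> (norm2 mu < norm2 la)%N) ->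
  let g := jack_op 'X N f - jack_eigenvalue 'X (part_mnm n la) *: f in
  forall mu, part mu -> coef mu g != 0 -> (norm2 mu < norm2 la)%N.
Proof.
move=> nN pl hf lt g mu pm; rewrite ltnNge; apply: contraNN => le.
have -> : g = 1 *: jack_op 'X N f - jack_eigenvalue 'X (part_mnm n la) *: f.
  by rewrite scale1r.
rewrite monomial_coeff_lin mul1r [X in X - _]mcoeff_jack_op; last first.
- move=> a' lt_a'; apply/eqP/negPn/negP => nz.
  have [nu [pn en cn]] := mcoeff_part hf nz; rewrite -cn in nz.
  have : (norm2 la < norm2 nu)%N by rewrite en; exact: leq_ltn_trans lt_a'.
  have [->|/(lt _ pn nz) lt_la] := eqVneq nu la; first by rewrite ltnn.
  by move=> /ltnW; rewrite leqNgt lt_la.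
- by apply: supportedW hf => m ->.
rewrite -monomial_coeffE; have [->|ne] := eqVneq mu la; first by rewrite subrr.
have -> : coef mu f = 0; last by rewrite !mulr0 subrr.
apply/eqP/negPn/negP => nz; have := lt _ pm nz ne; by rewrite ltnNge le.
Qed.

(** The truncation [N] is kept free, to be matched with the cut-off of the Hamiltonian on a given
    vector. *)
Theorem jack_eigenfunction N la : (n <= N)%N -> part la ->
  jack_op 'X N (J la) = jack_eigenvalue 'X (part_mnm n la) *: J la.
Proof.
move=> nN pl; set e := jack_eigenvalue _ _.
have hJ := psum_homog_jack pl.
pose g := jack_op 'X N (J la) - e *: J la.
have hg : psum_homog n g.
  by apply: supportedB; [exact: psum_homog_jack_op|exact: supportedZ].
have lg : forall mu, part mu -> coef mu g != 0 -> (norm2 mu < norm2 la)%N.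
  by apply: (jack_op_lower nN pl) => // mu pm nz ne; exact: jack_coeff_lt.
apply/eqP; rewrite -subr_eq0 -/g; apply/eqP/jack_scalar_eq0.
pose h := jack_op 'X N g - e *: g.
have -> : jack_scalar g g = jack_scalar h (J la).
  apply: etrans (psum_scalarBl _ _ _ _) _; apply: esym.
  apply: etrans (psum_scalarBl _ _ _ _) _; apply: f_equal2.
    exact: etrans (jack_op_adjoint _ _ _ _) (psum_scalarC _ _ _).
  congr (- _); apply: etrans (psum_scalarZl _ _ _ _) _.
  by apply: esym; apply: etrans (psum_scalarZl _ _ _ _) _; rewrite psum_scalarC.
have hh : psum_homog n h.
  by apply: supportedB; [exact: psum_homog_jack_op|exact: supportedZ].
refine (@jack_perp (norm2 la) h la hh _ pl (leqnn _)).
by apply: (jack_op_lower nN pl) => // mu pm nz _; exact: lg.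
Qed.

End JackEigenfunctions.

(** * The Hamiltonian on the Fock space *)

Section LinearMaps.
Variables (K : nzRingType) (V : lmodType K).
Implicit Types (T : V -> V) (c : K) (u v : V).

Definition is_linear T : Prop := forall c u v, T (c *: u + v) = c *: T u + T v.

Lemma is_linear_id : is_linear id.
Proof. by []. Qed.

Lemma is_linear_comp T T' :
  is_linear T -> is_linear T' -> is_linear (fun v => T (T' v)).
Proof. by move=> lT lT' c u v; rewrite lT' lT. Qed.

Lemma is_linearD T T' :
  is_linear T -> is_linear T' -> is_linear (fun v => T v + T' v).
Proof. by move=> lT lT' c u v; rewrite lT lT' scalerDr addrACA. Qed.

Lemma is_linear_sum (I : Type) (r : seq I) (T : I -> V -> V) :
  (forall i, is_linear (T i)) -> is_linear (fun v => \sum_(i <- r) T i v).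
Proof.
move=> lT c u v; rewrite scaler_sumr -big_split; apply: eq_bigr => i _.
exact: lT.
Qed.

Lemma is_linear_add T : is_linear T -> forall u v, T (u + v) = T u + T v.
Proof. by move=> lT u v; have := lT 1 u v; rewrite !scale1r. Qed.

Lemma is_linear0 T : is_linear T -> T 0 = 0.
Proof.
by move=> lT; apply: (addIr (T 0)); rewrite -(is_linear_add lT) !add0r.
Qed.

Lemma is_linearZ_apply T : is_linear T -> forall c u, T (c *: u) = c *: T u.
Proof. by move=> lT c u; have := lT c u 0; rewrite (is_linear0 lT) !addr0. Qed.

Lemma is_linear_sum_apply T : is_linear T ->
  forall (I : Type) (r : seq I) (F : I -> V),
  T (\sum_(i <- r) F i) = \sum_(i <- r) T (F i).
Proof.
move=> lT I r F.
exact: (big_morph T (is_linear_add lT) (is_linear0 lT)).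
Qed.

End LinearMaps.

Lemma is_linearZ (K : comNzRingType) (V : lmodType K) (a : K) (T : V -> V) :
  is_linear T -> is_linear (fun v => a *: T v).
Proof. by move=> lT c u v; rewrite lT scalerDr !scalerA mulrC. Qed.

Lemma is_linearB (K : comNzRingType) (V : lmodType K) (T T' : V -> V) :
  is_linear T -> is_linear T' -> is_linear (fun v => T v - T' v).
Proof.
move=> lT lT' c u v; rewrite lT lT' scalerBr opprD addrACA.
by [].
Qed.

Lemma is_linearM (K : comNzRingType) (S : comAlgType K) (a : S) :
  is_linear (fun v => a * v).
Proof. by move=> c u v; rewrite mulrDr scalerAr. Qed.

Lemma malgZU (K : comNzRingType) (I : choiceType) (c d : K) (m : {cmonom I}) :
  c *: << d *g m >> = << c * d *g m >> :> {malg K[{cmonom I}]}.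
Proof.
apply/malgP => m'; apply: etrans (mcoeffZ _ _ _) _.
by rewrite -> !mcoeffU; exact: mulrnAr.
Qed.

Section FockOperators.
Variable C : numClosedFieldType.
Local Notation fock := {malg C[{cmonom (bool * nat)%type}]}.
Implicit Types (u v : fock) (s : bool) (m : {cmonom (bool * nat)%type}).

Lemma annihilationE s k v : annihilation s k v = k.+1%:R *: pderiv (s, k) v.
Proof.
rewrite unlock scaler_sumr; apply: eq_bigr => m _.
apply: esym; apply: etrans (malgZU _ _ _) _; congr << _ *g _ >>.
by rewrite -mulrA; congr (_ * _); rewrite mulr_natl.
Qed.

(** The index [k] is the mode [k.+1]. A vector bounded by [N] is killed by the annihilators of index
    at least [N], which cuts the infinite sums over modes. *)
Definition bounded (N : nat) v : Prop :=
  supported (fun m => forall x, (N <= x.2)%N -> m x = 0%N) v.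

Lemma bounded_exists v : exists N, bounded N v.
Proof.
exists (\max_(m <- msupp v) \max_(x <- finsupp m) x.2.+1)%N => m mv x Nx.
apply/eqP; rewrite -leqn0 leqNgt -msupp_cmonom; apply/negP => xm.
have : (x.2 < \max_(m <- msupp v) \max_(x <- finsupp m) x.2.+1)%N.
  apply: leq_trans (leq_bigmax_seq _ mv isT).
  exact: (leq_bigmax_seq (F := fun x : bool * nat => x.2.+1) _ xm isT).
by rewrite ltnNge Nx.
Qed.

Lemma boundedW N M v : (N <= M)%N -> bounded N v -> bounded M v.
Proof.
move=> NM; apply: supportedW => m h x Mx; apply: h; exact: leq_trans Mx.
Qed.

Lemma pderiv_bounded N s k v : bounded N v -> (N <= k)%N -> pderiv (s, k) v = 0.
Proof. by move=> vN Nk; apply: pderiv_eq0; apply: supportedW vN => m; exact. Qed.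

Lemma bounded_pderiv N x v : bounded N v -> bounded N (pderiv x v).
Proof.
move=> vN; apply: supportedW (supported_pderiv (x := x) vN) => m h y /h.
by rewrite cmM => /eqP; rewrite addn_eq0 => /andP[/eqP].
Qed.

Variables (P b : C).

Definition zero_mode s : C := if s then 'i * P else - ('i * P).

(** Modes are shifted by one: [i] and [j] stand for the modes [i.+1] and [j.+1], whose sum is the
    mode of index [(i + j).+1]. *)
Definition Hsign_fin (N : nat) s v : fock :=
  - 'i *: (\sum_(i < N) \sum_(j < N)
     (creation C s (i + j).+1 * annihilation s i (annihilation s j v) +
      creation C s i * (creation C s j * annihilation s (i + j).+1 v)))
  + \sum_(k < N) (let w := creation C s k * annihilation s k v in
      (Qb b * k.+1%:R) *: w - (2 * 'i) *: (zero_mode s *: w))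
  - ('i / 3) *: (zero_mode s *: (zero_mode s *: (zero_mode s *: v))).

Lemma oscN s k v : osc P s (- k.+1%:Z) v = creation C s k * v.
Proof. by []. Qed.

Lemma oscP s k v : osc P s k.+1%:Z v = annihilation s k v.
Proof. by []. Qed.

Lemma fsum_seq (T : choiceType) (A : set T) (r : seq T) (F : T -> fock) :
  uniq r -> (forall x, x \in r -> A x) ->
  (forall x, A x -> x \notin r -> F x = 0) ->
  \sum_(x \in A) F x = \sum_(x <- r) F x.
Proof.
move=> ur rA F0; rewrite (fsbigE r) // big_seq_cond [RHS]big_seq.
by apply: eq_bigl => x; apply: andb_idr => /rA Ax; rewrite inE.
Qed.

Lemma fsum_pos (F : nat -> fock) N : (forall k, (N <= k)%N -> F k.+1 = 0) ->
  \sum_(k \in [set k : nat | (0 < k)%N]) F k = \sum_(k < N) F k.+1.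
Proof.
move=> F0; rewrite (@fsum_seq _ _ [seq k.+1 | k <- iota 0 N]).
- by rewrite big_map -{1}[N]subn0 -/(index_iota 0 N) big_mkord.
- by rewrite map_inj_uniq ?iota_uniq // => i j [].
- by move=> _ /mapP[k _ ->].
move=> [|k] // _ nk; apply: F0; rewrite leqNgt; apply: contra nk => kN.
by apply/mapP; exists k; rewrite // mem_iota.
Qed.

Lemma fsum_pos2 (F : nat * nat -> fock) N :
  (forall i j, ~~ ((i < N) && (j < N))%N -> F (i.+1, j.+1) = 0) ->
  \sum_(p \in [set p : nat * nat | (0 < p.1)%N /\ (0 < p.2)%N]) F p =
  \sum_(i < N) \sum_(j < N) F (i.+1, j.+1).
Proof.
move=> F0.
pose r := [seq k.+1 | k <- iota 0 N].
have ur : uniq r by rewrite map_inj_uniq ?iota_uniq // => i j [].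
have big_r (G : nat -> fock) : \sum_(i <- r) G i = \sum_(i < N) G i.+1.
  by rewrite big_map -{1}[N]subn0 -/(index_iota 0 N) big_mkord.
rewrite (@fsum_seq _ _ [seq (i, j) | i <- r, j <- r]).
- by rewrite big_allpairs big_r; apply: eq_bigr => i _; rewrite big_r.
- by apply: allpairs_uniq => // -[i j] [i' j'] _ _ /= [-> ->].
- by move=> _ /allpairsP[[i j] [/mapP[i' _ /= ->] /mapP[j' _ /= ->] ->]].
move=> [[|i] [|j]] [] // _ _ nij; apply: F0; apply: contra nij => /andP[iN jN].
by apply/allpairsP; exists (i.+1, j.+1); rewrite /= !mem_map ?mem_iota //;
  apply: succn_inj.
Qed.

(** If [i] or [j] is at least [N], each of the two cubic terms contains an annihilator of index at
    least [N], and annihilators preserve the bound. *)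
Lemma Hsign_finE N s v : bounded N v -> Hsign P b s v = Hsign_fin N s v.
Proof.
move=> vN.
have A0 k u : bounded N u -> (N <= k)%N -> annihilation s k u = 0.
  by move=> uN Nk; rewrite annihilationE (pderiv_bounded _ uN Nk) scaler0.
have AN k u : bounded N u -> bounded N (annihilation s k u).
  by move=> uN; rewrite annihilationE; apply: supportedZ; exact: bounded_pderiv.
have e i j : (i.+1 + j.+1 = (i + j).+2)%N by lia.
apply: (f_equal2 +%R); last exact: erefl.
apply: (f_equal2 +%R).
  apply: (congr1 ( *:%R (- 'i))).
  apply: etrans (fsum_pos2 (N := N) _) _ => [i j nij|].
    rewrite [(_, _).1]/= [(_, _).2]/= e; rewrite -> !oscN, !oscP.
    have -> : annihilation s (i + j).+1 v = 0 by apply: A0 => //; lia.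
    have -> : annihilation s i (annihilation s j v) = 0.
      have [Nj|jN] := leqP N j; last by apply: A0; [exact: AN|lia].
      by rewrite (A0 j v vN Nj) annihilationE pderiv0 scaler0.
    apply: etrans (f_equal2 +%R (mulr0 _) _) (addr0 _).
    exact: etrans (congr1 ( *%R _) (mulr0 _)) (mulr0 _).
  apply: eq_bigr => i _; apply: eq_bigr => j _.
  by rewrite [(_, _).1]/= [(_, _).2]/= e; rewrite -> !oscN, !oscP.
apply: etrans (fsum_pos (N := N) _) _ => [k Nk|//].
have -> : osc P s (- k.+1%:Z) (osc P s k.+1%:Z v) = 0.
  by rewrite -> oscN, oscP; rewrite (A0 k v vN Nk); exact: mulr0.
have e0 : osc P s 0 0 = 0 by exact: scaler0.
by cbv zeta; rewrite e0 !scaler0 subr0.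
Qed.

End FockOperators.

Section FockLinearity.
Variable C : numClosedFieldType.
Local Notation fock := {malg C[{cmonom (bool * nat)%type}]}.
Implicit Types (u v w : fock) (s : bool) (m : {cmonom (bool * nat)%type}).
Variables (P b : C).

Lemma is_linear_annihilation s k : @is_linear C fock (annihilation s k).
Proof.
move=> c u v; rewrite !annihilationE; move: (k.+1%:R) => a.
apply: (is_linearZ a (T := pderiv (s, k))) => {c u v} c u v.
exact: pderiv_is_linear.
Qed.

Lemma is_linear_creation s k : @is_linear C fock (fun v => creation C s k * v).
Proof. exact: is_linearM. Qed.

Lemma is_linear_Hsign_fin N s : @is_linear C fock (Hsign_fin P b N s).
Proof.
have la k := @is_linear_annihilation s k; have lc k := @is_linear_creation s k.
rewrite /Hsign_fin; apply: is_linearB; last first.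
  by do 4!apply: is_linearZ.
apply: is_linearD.
  apply: is_linearZ; apply: is_linear_sum => i; apply: is_linear_sum => j.
  apply: is_linearD; apply: (is_linear_comp (lc _)).
    exact: is_linear_comp.
  exact: (is_linear_comp (lc _)).
apply: is_linear_sum => k; cbv zeta.
have lw := is_linear_comp (lc k) (la k).
by apply: is_linearB; do ?apply: is_linearZ.
Qed.

Lemma bounded3 u v w : exists N, [/\ bounded N u, bounded N v & bounded N w].
Proof.
have [N1 h1] := bounded_exists u; have [N2 h2] := bounded_exists v.
have [N3 h3] := bounded_exists w.
exists (N1 + N2 + N3)%N.
by split; [apply: boundedW h1|apply: boundedW h2|apply: boundedW h3]; lia.
Qed.

Lemma is_linear_Hsign s : @is_linear C fock (Hsign P b s).
Proof.
move=> c u v; have [N [hw hu hv]] := bounded3 (c *: u + v) u v.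
rewrite (Hsign_finE _ _ _ hw) (Hsign_finE _ _ _ hu) (Hsign_finE _ _ _ hv).
exact: is_linear_Hsign_fin.
Qed.

Lemma is_linear_H0 : @is_linear C fock (H0 P b).
Proof. by apply: is_linearD; exact: is_linear_Hsign. Qed.

Definition HI_fin N v : fock := \sum_(k < N)
  (2 * Qb b * k.+1%:R) *: (creation C true k * annihilation false k v).

Lemma HI_finE N v : bounded N v -> HI P b v = HI_fin N v.
Proof.
move=> vN; apply: etrans (fsum_pos (N := N) _) _ => [k Nk|//].
have -> : osc P true (- k.+1%:Z) (osc P false k.+1%:Z v) = 0.
  rewrite -> oscN, oscP; rewrite annihilationE (pderiv_bounded _ vN Nk) scaler0.
  exact: mulr0.
exact: scaler0.
Qed.

Lemma is_linear_HI : @is_linear C fock (HI P b).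
Proof.
move=> c u v; have [N [hw hu hv]] := bounded3 (c *: u + v) u v.
rewrite (HI_finE hw) (HI_finE hu) (HI_finE hv).
suff : @is_linear C fock (HI_fin N) by exact.
apply: is_linear_sum => k; apply: is_linearZ.
exact: (is_linear_comp (@is_linear_creation _ _) (@is_linear_annihilation _ _)).
Qed.

Lemma degreeM s m m' : degree s (m *c m') = (degree s m + degree s m')%N.
Proof.
rewrite /degree big_mkcond [X in (X + _)%N]big_mkcond [X in (_ + X)%N]big_mkcond.
apply: (@big_finsuppM _ _ _ _ (fun x i => if x.1 == s then i * x.2.+1 else 0)%N).
  by move=> x; case: ifP.
by move=> x i j; case: ifP => // _; exact: mulnDl.
Qed.

Lemma degreeU s t k : degree s (ucm (t, k)) = (if t == s then k.+1 else 0)%N.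
Proof.
rewrite /degree big_mkcond.
apply: etrans (big_finsuppU _ (fun x i => if x.1 == s then i * x.2.+1 else 0)%N _) _.
by rewrite /= mul1n.
Qed.

Lemma supported_annihilation s k D v : supported D v ->
  supported (fun m => D (m *c ucm (s, k))) (annihilation s k v).
Proof.
by move=> h; rewrite annihilationE; apply: supportedZ; exact: supported_pderiv.
Qed.

Lemma supported_creation s k D v : supported D v ->
  supported (fun m => exists2 m', D m' & m = m' *c ucm (s, k)) (creation C s k * v).
Proof. exact: supported_mul_ucm. Qed.

(** Each term creates the total mode number that it annihilates. [D] is arbitrary so that it can
    also be the complement of a bidegree, as in [T_injective]. *)
Lemma graded_Hsign D s v : graded D v -> graded D (Hsign P b s v).
Proof.
pose D' m := D (degree true m) (degree false m).
move=> hv; have {}hv : supported D' v by exact: hv.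
suff : supported D' (Hsign P b s v) by [].
have DE m m' : (forall t, degree t m = degree t m') -> D' m -> D' m'.
  by move=> e; rewrite /D' !e.
have [N vN] := bounded_exists v; rewrite (Hsign_finE _ _ _ vN).
apply: supportedB; last by do 4!apply: supportedZ.
apply: supportedD.
  apply: supportedZ; apply: supported_sum => i _; apply: supported_sum => j _.
  apply: supportedD.
    have := supported_creation (s := s) (k := (i + j).+1)
      (supported_annihilation (s := s) (k := i)
        (supported_annihilation (s := s) (k := j) hv)).
    apply: supportedW => m [m' h ->]; apply: DE h => t.
    by rewrite !degreeM !degreeU; case: ifP => // _; lia.
  have := supported_creation (s := s) (k := i) (supported_creation (s := s) (k := j)
      (supported_annihilation (s := s) (k := (i + j).+1) hv)).
  apply: supportedW => m [_ [m' h ->] ->]; apply: DE h => t.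
  by rewrite !degreeM !degreeU; case: ifP => // _; lia.
apply: supported_sum => k _; cbv zeta.
have hw : supported D' (creation C s k * annihilation s k v).
  have := supported_creation (s := s) (k := k)
    (supported_annihilation (s := s) (k := k) hv).
  by apply: supportedW => m [m' h ->].
by apply: supportedB; do ?apply: supportedZ.
Qed.

Lemma graded_H0 D v : graded D v -> graded D (H0 P b v).
Proof. by move=> hv; apply: supportedD; exact: graded_Hsign. Qed.

Lemma graded_HI D v : graded D v ->
  graded (fun p q => exists k, [/\ (k < p)%N & D (p - k.+1)%N (q + k.+1)%N]) (HI P b v).
Proof.
move=> hv; have [N vN] := bounded_exists v; rewrite (HI_finE vN).
have {}hv : supported (fun m => D (degree true m) (degree false m)) v by exact: hv.
suff : supported (fun m => exists k, [/\ (k < degree true m)%N &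
    D (degree true m - k.+1)%N (degree false m + k.+1)%N]) (HI_fin N v) by [].
apply: supported_sum => k _; apply: supportedZ.
have := supported_creation (s := true) (k := k)
  (supported_annihilation (s := false) (k := k) hv).
apply: supportedW => _ [m h ->]; exists k.
rewrite !degreeM !degreeU /= in h *; rewrite addn0 in h.
by rewrite addn0 addnK; split=> //; lia.
Qed.

End FockLinearity.

(** Rests on [- 'i * c = - b * t], [- 'i * c^-1 = - b] and [- b * (t - 1) = Qb b]. The square of
    [k.+1] in the quadratic term splits into [k.+1 * k], which belongs to the Laplace-Beltrami
    operator, and [k.+1], which Euler's identity sums to the degree. *)
Lemma hamiltonian_combination (C : numClosedFieldType) (V : lmodType C) (N n : nat)
    (b z : C) (E0 : V) (E1 E2 : nat -> nat -> V) (E3 : nat -> V) :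
  b != 0 -> \sum_(k < N) k.+1%:R *: E3 k = n%:R *: E0 ->
  let c := (- ('i * b))^-1 in let t := - (b ^+ 2)^-1 in
  - 'i *: (\sum_(i < N) \sum_(j < N) ((i.+1%:R * j.+1%:R * c) *: E1 i j
      + ((i + j).+2%:R * c^-1) *: E2 i j))
  + \sum_(k < N) ((Qb b * k.+1%:R) *: (k.+1%:R *: E3 k)
      - (2 * 'i) *: (z *: (k.+1%:R *: E3 k)))
  - ('i / 3) *: (z *: (z *: (z *: E0)))
  = - b *: (\sum_(i < N) \sum_(j < N) ((t * (i.+1 * j.+1)%:R) *: E1 i j
      + (i + j).+2%:R *: E2 i j)
    + \sum_(k < N) ((t - 1) * (k.+1 * k)%:R) *: E3 k)
  + (Qb b * n%:R - 2 * 'i * z * n%:R - 'i / 3 * z ^+ 3) *: E0.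
Proof.
move=> b0 euler c t.
have i2 : 'i ^+ 2 = -1 :> C := sqrCi C.
have i0 : ('i : C) != 0 := neq0Ci C.
have ic : - 'i * c = - b * t.
  by rewrite /c /t; field; rewrite i0 b0.
have ic' : - 'i * c^-1 = - b.
  by rewrite /c invrK mulNr mulrN opprK mulrA -expr2 i2 mulN1r.
have -> : - 'i *: (\sum_(i < N) \sum_(j < N) ((i.+1%:R * j.+1%:R * c) *: E1 i j
      + ((i + j).+2%:R * c^-1) *: E2 i j)) =
   - b *: (\sum_(i < N) \sum_(j < N) ((t * (i.+1 * j.+1)%:R) *: E1 i j
      + (i + j).+2%:R *: E2 i j)).
  rewrite !scaler_sumr; apply: eq_bigr => i _; rewrite !scaler_sumr.
  apply: eq_bigr => j _; rewrite !scalerDr !scalerA; congr (_ *: _ + _ *: _).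
    by rewrite mulrCA ic natrM; ring.
  by rewrite mulrCA ic' mulrC.
rewrite scalerDr -!addrA; congr (_ + _); rewrite !addrA.
have bt : - b * (t - 1) = Qb b by rewrite /t /Qb; field.
have -> : (Qb b * n%:R - 2 * 'i * z * n%:R - 'i / 3 * z ^+ 3) *: E0 =
    (Qb b - 2 * 'i * z) *: (n%:R *: E0) - ('i / 3 * z ^+ 3) *: E0.
  by rewrite scalerA -scalerBl mulrBl.
rewrite addrA -euler; congr (_ - _); last by rewrite !scalerA; congr (_ *: _); ring.
rewrite !scaler_sumr -big_split; apply: eq_bigr => k _ /=.
rewrite !scalerA -scalerBl -scalerDl mulrA bt; congr (_ *: _).
by rewrite natrM; ring.
Qed.

(** * Jack states as images of Jack functions *)

Module JackMorphism.
Section JackStates.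
Variable C : numClosedFieldType.
Local Notation fock := {malg C[{cmonom (bool * nat)%type}]}.
Variables (P b : C).
Implicit Types (f g : psymfun {poly rat}) (s : bool) (h : fock).

Definition specialize (c : {poly rat}) : C :=
  (map_poly ratr c).[- (b ^+ 2)^-1].

HB.instance Definition _ := GRing.RMorphism.copy specialize
  (horner_eval (- (b ^+ 2)^-1) \o map_poly ratr).

Definition specializeC (c : {poly rat}) : fock := malgC (specialize c).

HB.instance Definition _ := GRing.RMorphism.copy specializeC
  (@malgC _ C \o specialize).

Let c0 : C := (- ('i * b))^-1.

Definition jack_state_morphism s : psymfun {poly rat} -> fock :=
  psum_eval specializeC (fun n => c0 *: creation C s n.-1).

HB.instance Definition _ s := GRing.RMorphism.copy (jack_state_morphism s)
  (psum_eval specializeC (fun n => c0 *: creation C s n.-1)).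

Lemma jack_state_morphismU s k :
  jack_state_morphism s << ucm k >> = c0 *: creation C s k.
Proof. exact: psum_evalU. Qed.

Lemma jack_state_morphismC s (c : {poly rat}) :
  jack_state_morphism s c%:MP = (specialize c)%:MP.
Proof. exact: psum_evalC. Qed.

Lemma jack_state_morphismZ s (c : {poly rat}) f :
  jack_state_morphism s (c *: f) = specialize c *: jack_state_morphism s f.
Proof. by apply: etrans (psum_evalZ _ _ _ _) _; exact: mul_malgC. Qed.

Lemma psum_weight_bounded f : exists N, supported (fun m => psum_weight m <= N)%N f.
Proof.
exists (\max_(m <- msupp f) psum_weight m)%N => m mf.
exact: (leq_bigmax_seq (F := psum_weight) _ mf isT).
Qed.

Lemma pderiv_jack_state s t k f : pderiv (s, k) (jack_state_morphism t f) =
  if t == s then c0 *: jack_state_morphism t (pderiv k f) else 0.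
Proof.
have [N0 fN0] := psum_weight_bounded f; pose N := (N0 + k.+1)%N.
have fN : supported (fun m => psum_weight m <= N)%N f.
  by apply: supportedW fN0 => m; rewrite /N; lia.
have kN : (k < N)%N by rewrite /N; lia.
apply: etrans (chain_rule (phi := jack_state_morphism t) (d := pderiv (s, k))
  (N := N) _ _ _ fN) _.
- exact: pderivD.
- exact: pderivM.
- move=> c; rewrite (congr1 (pderiv (s, k)) (jack_state_morphismC t c)).
  exact: pderivC.
have dU (j : nat) : pderiv (s, k) (jack_state_morphism t << ucm j >>) =
    c0 *: ((s, k) == (t, j))%:R.
  apply: etrans (congr1 (pderiv (s, k)) (jack_state_morphismU t j)) _.
  apply: etrans (pderivZ _ _ _) _; congr (_ *: _); exact: pderiv_ucm.
under eq_bigr => j _ do rewrite dU xpair_eqE.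
have [_|_] := eqVneq t s; last first.
  by apply: big1 => j _; rewrite /= scaler0; exact: mulr0.
rewrite (bigD1 (Ordinal kN)) //= eqxx [X in _ + X]big1 => [|j jk]; last first.
  have -> : (k == j) = false.
    by apply: contra_neqF jk => /eqP kj; apply/val_inj.
  by rewrite scaler0; exact: mulr0.
apply: etrans (addr0 _) _; apply: etrans (esym (scalerAr _ _ _)) _.
congr (_ *: _); exact: mulr1.
Qed.

End JackStates.
End JackMorphism.
Import JackMorphism.

Section JackStateEnergy.
Variable C : numClosedFieldType.
Local Notation fock := {malg C[{cmonom (bool * nat)%type}]}.
Variables (P b : C).
Hypothesis b0 : b != 0.
Implicit Types (f g : psymfun {poly rat}) (s : bool) (h : fock).

Local Notation phi := (jack_state_morphism b).
Local Notation c0 := ((- ('i * b))^-1 : C).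

Section Factor.
Variables (s : bool) (h : fock).
Hypothesis hh : forall k, pderiv (s, k) h = 0.

(** [h] will be the Jack state of the other sign, or 1: killed by the derivatives of sign [s], it is
    a scalar for [Hsign] of that sign. *)
Definition jack_factor f : fock := phi s f * h.

Lemma jack_factorD : {morph jack_factor : f g / f + g}.
Proof. by move=> f g; rewrite /jack_factor raddfD; exact: mulrDl. Qed.

Lemma jack_factor0 : jack_factor 0 = 0.
Proof. by rewrite /jack_factor raddf0; exact: mul0r. Qed.

Lemma jack_factor_sum (I : Type) (r : seq I) (F : I -> psymfun {poly rat}) :
  jack_factor (\sum_(i <- r) F i) = \sum_(i <- r) jack_factor (F i).
Proof. exact: (big_morph _ jack_factorD jack_factor0). Qed.

Lemma jack_factorZ (c : {poly rat}) f :
  jack_factor (c *: f) = specialize b c *: jack_factor f.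
Proof.
apply: etrans (congr1 ( *%R^~ h) (jack_state_morphismZ b s c f)) _.
exact: esym (scalerAl _ _ _).
Qed.

Lemma pderiv_jack_factor k f :
  pderiv (s, k) (jack_factor f) = c0 *: jack_factor (pderiv k f).
Proof.
apply: etrans (pderivM _ _ _) _.
rewrite hh; apply: etrans (congr1 (+%R _) (mulr0 _)) _; apply: etrans (addr0 _) _.
have e : pderiv (s, k) (phi s f) = c0 *: phi s (pderiv k f).
  by have := pderiv_jack_state b s s k f; rewrite eqxx.
by rewrite e; exact: esym (scalerAl _ _ _).
Qed.

Lemma annihilation_jack_factor k f :
  annihilation s k (jack_factor f) = (k.+1%:R * c0) *: jack_factor (pderiv k f).
Proof.
rewrite annihilationE; apply: etrans (congr1 _ (pderiv_jack_factor k f)) _.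
exact: scalerA.
Qed.

Lemma opp_Ci_mul_neq0 : - ('i * b) != 0.
Proof. by rewrite oppr_eq0 mulf_eq0 negb_or neq0Ci. Qed.

Lemma creation_jack_factor k f :
  creation C s k * jack_factor f = c0^-1 *: jack_factor (<< ucm k >> * f).
Proof.
have e : phi s (<< ucm k >> * f) = (c0 *: creation C s k) * phi s f.
  apply: etrans (rmorphM (phi s) _ _) _; congr (_ * _).
  exact: jack_state_morphismU.
rewrite /jack_factor e; apply: etrans (mulrA _ _ _) _; apply: esym.
apply: etrans (scalerAl _ _ _) _; congr (_ * _).
apply: etrans (congr1 _ (esym (scalerAl _ _ _))) _.
apply: etrans (scalerA _ _ _) _.
have -> : c0^-1 * c0 = 1 by rewrite mulVf // invr_eq0 opp_Ci_mul_neq0.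
exact: scale1r.
Qed.

Lemma annihilationZ k (c : C) h' :
  annihilation s k (c *: h') = c *: annihilation s k h'.
Proof. exact: (is_linearZ_apply (@is_linear_annihilation C s k)). Qed.

Lemma creationZ k (c : C) h' :
  creation C s k * (c *: h') = c *: (creation C s k * h').
Proof. exact: (is_linearZ_apply (@is_linear_creation C s k)). Qed.

(** Each annihilator brings a factor [c0] and each creator a factor [c0^-1], so the two cubic terms
    acquire [c0] and [c0^-1] as in [hamiltonian_combination]. *)
Lemma Hsign_jack_factor n N f : psum_homog n f -> (n <= N)%N ->
  bounded N (jack_factor f) -> Hsign P b s (jack_factor f) =
  - b *: jack_factor (jack_op 'X N f) +
  (Qb b * n%:R - 2 * 'i * zero_mode P s * n%:R - 'i / 3 * zero_mode P s ^+ 3)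
    *: jack_factor f.
Proof.
move=> fn nN vN; rewrite (Hsign_finE _ _ _ vN).
pose E1 i j := jack_factor (<< ucm (i + j).+1 >> * pderiv i (pderiv j f)).
pose E2 i j := jack_factor (<< ucm i >> * (<< ucm j >> * pderiv (i + j).+1 f)).
pose E3 k := jack_factor (<< ucm k >> * pderiv k f).
have spec_nat k : specialize b k%:R = k%:R by exact: rmorph_nat.
have euler : \sum_(k < N) k.+1%:R *: E3 k = n%:R *: jack_factor f.
  rewrite -[in RHS]spec_nat -jack_factorZ -(euler_homog nN fn) jack_factor_sum.
  by apply: eq_bigr => k _; rewrite jack_factorZ spec_nat.
have specX : specialize b 'X = - (b ^+ 2)^-1.
  by rewrite /specialize map_polyX hornerX.
have -> : jack_factor (jack_op 'X N f) =
    \sum_(i < N) \sum_(j < N) ((- (b ^+ 2)^-1 * (i.+1 * j.+1)%:R) *: E1 i j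
      + (i + j).+2%:R *: E2 i j)
    + \sum_(k < N) ((- (b ^+ 2)^-1 - 1) * (k.+1 * k)%:R) *: E3 k.
  rewrite jack_factorD !jack_factor_sum; congr (_ + _).
    apply: eq_bigr => i _; rewrite jack_factor_sum; apply: eq_bigr => j _.
    apply: etrans (jack_factorD _ _) _; apply: (f_equal2 +%R).
      apply: etrans (jack_factorZ _ _) _.
      by rewrite rmorphM /= specX spec_nat; exact: erefl.
    by apply: etrans (jack_factorZ _ _) _; rewrite spec_nat; exact: erefl.
  apply: eq_bigr => k _; apply: etrans (jack_factorZ _ _) _.
  by rewrite rmorphM rmorphB rmorph1 /= specX spec_nat; exact: erefl.
rewrite -(hamiltonian_combination (zero_mode P s) E1 E2 b0 euler).
have w k : creation C s k * annihilation s k (jack_factor f) = k.+1%:R *: E3 k.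
  rewrite annihilation_jack_factor; apply: etrans (creationZ _ _ _) _.
  apply: etrans (congr1 _ (creation_jack_factor _ _)) _.
  apply: etrans (scalerA _ _ _) _; apply: (congr1 (fun c : C => c *: E3 k)).
  by rewrite -mulrA mulfV ?mulr1 // invr_eq0 opp_Ci_mul_neq0.
apply: (f_equal2 +%R); last exact: erefl.
apply: (f_equal2 +%R); last by apply: eq_bigr => k _; cbv zeta; rewrite w.
apply: (congr1 ( *:%R (- 'i))); apply: eq_bigr => i _; apply: eq_bigr => j _.
have c0V : c0 * c0^-1 = 1 by rewrite mulfV // invr_eq0 opp_Ci_mul_neq0.
apply: (f_equal2 +%R).
  rewrite annihilation_jack_factor annihilationZ annihilation_jack_factor.
  apply: etrans (congr1 _ (scalerA _ _ _)) _; apply: etrans (creationZ _ _ _) _.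
  apply: etrans (congr1 _ (creation_jack_factor _ _)) _.
  apply: etrans (scalerA _ _ _) _; apply: (congr1 (fun c : C => c *: E1 i j)).
  move: (c0) (c0^-1) c0V => c c' cc'.
  transitivity (i.+1%:R * j.+1%:R * c * (c * c')); first by ring.
  by rewrite cc' mulr1.
rewrite annihilation_jack_factor.
apply: etrans (congr1 _ (creationZ _ _ _)) _; apply: etrans (creationZ _ _ _) _.
apply: etrans (congr1 (fun u => _ *: (_ * u)) (creation_jack_factor _ _)) _.
apply: etrans (congr1 _ (creationZ _ _ _)) _.
apply: etrans (congr1 (fun u => _ *: (_ *: u)) (creation_jack_factor _ _)) _.
apply: etrans (congr1 _ (scalerA _ _ _)) _.
apply: etrans (scalerA _ _ _) _; apply: (congr1 (fun c : C => c *: E2 i j)).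
move: (c0) (c0^-1) c0V => c c' cc'.
transitivity ((i + j).+2%:R * c' * (c * c')); first by ring.
by rewrite cc' mulr1.
Qed.

Lemma iter_pderiv_jack_factor n f :
  iter n (pderiv (s, 0)) (jack_factor f) =
  c0 ^+ n *: jack_factor (iter n (pderiv 0) f).
Proof.
elim: n => [|n IH]; first by rewrite expr0; exact: esym (scale1r _).
rewrite iterS IH; apply: etrans (pderivZ _ _ _) _.
apply: etrans (congr1 _ (pderiv_jack_factor 0 _)) _.
have e : c0 ^+ n * c0 = c0 ^+ n.+1 by rewrite exprSr.
exact: etrans (scalerA _ _ _) (congr1 (fun c : C => c *: _) e).
Qed.

End Factor.
End JackStateEnergy.

(** * Nonvanishing of Jack functions at every parameter *)

Lemma psum_homog0 (K : comNzRingType) (f : psymfun K) :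
  psum_homog 0 f -> f = (f@_mone)%:MP.
Proof.
move=> hf; apply/malgP => m; rewrite mcoeffC.
have [->|m1] := eqVneq m mone; first by rewrite mulr1n.
apply: mcoeff_outdom; apply: contra m1 => /hf m0.
apply/cmP => k; rewrite cm1; apply/eqP; rewrite -leqn0 leqNgt.
by apply/negP => /psum_weight_lt; rewrite m0.
Qed.

Lemma psum_homog_iter_pderiv (K : comNzRingType) n (f : psymfun K) :
  psum_homog n f -> psum_homog 0 (iter n (pderiv 0) f).
Proof.
elim: n f => [//|n IH] f hf; rewrite iterSr; apply: IH.
by have := psum_homog_pderiv (k := 0) hf; rewrite subn1.
Qed.

Definition monom_pow (I : choiceType) (x : I) (n : nat) (m : {cmonom I}) : {cmonom I} :=
  iter n (fun m => m *c ucm x) m.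

Lemma mcoeff_iter_pderiv (I : choiceType) (K : comNzRingType) (x : I) n
    (f : {malg K[{cmonom I}]}) m :
  exists k, (iter n (pderiv x) f)@_m = f@_(monom_pow x n m) *+ k.+1.
Proof.
elim: n m => [|n IH] m; first by exists 0%N.
have [k e] := IH (m *c ucm x); exists (k.+1 * (m x).+1).-1.
rewrite iterS mcoeff_pderiv e -mulrnA /monom_pow iterSr; congr (_ *+ _).
Qed.

Lemma monom_powE (I : choiceType) (x y : I) n :
  monom_pow x n mone y = (if y == x then n else 0)%N.
Proof.
elim: n => [|n IH] /=; first by rewrite cm1 if_same.
by rewrite cmM ucmE IH eq_sym; case: eqP; rewrite ?addn1.
Qed.

Section Nonvanishing.
Import mpoly.
Variables (n : nat).
Local Notation a1 := [multinom nth 0%N (nseq n 1%N) i | i < n].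
Implicit Types f : psymfun {poly rat}.

Lemma mcoeff_psum_sqfree k (p : mpoly.mpoly n {poly rat}) :
  mpoly.mcoeff a1 ((\sum_(i < n) 'X_i ^+ k.+2) * p) = 0.
Proof.
rewrite mulr_suml raddf_sum big1 // => i _ /=.
rewrite !exprS -!mulrA mcoeffMXU; case: ifP => // _; rewrite mcoeffMXU.
by rewrite mnmBE mnm1E mnmE nth_nseq ltn_ord eqxx.
Qed.

(** Such a monomial contains some [p_j] with [j >= 2], no multiple of which has a squarefree
    monomial. *)
Lemma monomial_coeff_monom c m : psum_weight m = n -> m != monom_pow 0%N n mone ->
  monomial_coeff n (nseq n 1%N) << c *g m >> = 0.
Proof.
move=> mn ne.
have [k mk] : exists k, (0 < m k.+1)%N.
  (* If only [p_1] occurred, the weight would force [m] to be its [n]-th power. *)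
  apply/not_existsP => h; case/eqP: ne; apply/eqP/cmP => -[|k]; rewrite monom_powE /=.
    rewrite -mn -{2}[m](_ : monom_pow 0%N (m 0%N) mone = m).
      elim: (m 0%N) => [|i IH]; first by rewrite /psum_weight mdom1 big_seq_fset0.
      by rewrite /= psum_weightM psum_weightU -IH addn1.
    apply/eqP/cmP => -[|k]; rewrite monom_powE //=.
    by apply/esym/eqP; rewrite -leqn0 leqNgt; apply/negP/h.
  by apply/eqP; rewrite -leqn0 leqNgt; apply/negP/h.
have -> : << c *g m >> =
    << ucm k.+1 >> * << c *g divcm m (ucm k.+1) >> :> psymfun {poly rat}.
  by rewrite mul_monom mul1r mulmC (mulcm_divcm mk).
pose phi : {rmorphism psymfun {poly rat} -> mpoly.mpoly n {poly rat}} :=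
  @psum_vars n {poly rat}.
have e f g : psum_vars n (f * g) = psum_vars n f * psum_vars n g := rmorphM phi f g.
rewrite /monomial_coeff; apply: etrans (congr1 (mpoly.mcoeff a1) (e _ _)) _.
apply: etrans (congr1 (fun q => mpoly.mcoeff a1 (q * _)) (psum_varsU n _ k.+1)) _.
exact: mcoeff_psum_sqfree.
Qed.

(** Only the term of [f] in [p_1 ^ n] contributes to [x_1 ... x_n]. [psi] will be the specialization
    of alpha. *)
Lemma specialized_coeff_neq0 (S : comNzRingType) (psi : {rmorphism {poly rat} -> S}) f :
  psum_homog n f ->
  psi (monomial_coeff n (nseq n 1%N) f) != 0 ->
  psi (monalg.mcoeff (monom_pow 0%N n mone) f) != 0.
Proof.
move=> hf; apply: contraNneq => f0.
pose phi : {rmorphism psymfun {poly rat} -> mpoly.mpoly n {poly rat}} :=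
  @psum_vars n {poly rat}.
have cE g : monomial_coeff n (nseq n 1%N) g = mpoly.mcoeff a1 (phi g) by [].
have -> : monomial_coeff n (nseq n 1%N) f = \sum_(m <- monalg.msupp f)
    mpoly.mcoeff a1 (phi << monalg.mcoeff m f *g m >>).
  rewrite cE {1}(monalgE f) (raddf_sum phi); exact: raddf_sum.
rewrite raddf_sum big1_seq // => m /andP[_ mf] /=.
have mn : psum_weight m = n := hf m mf.
have [em|ne] := eqVneq m (monom_pow 0%N n mone); last first.
  by rewrite -[mpoly.mcoeff _ _]cE monomial_coeff_monom // rmorph0.
have eZ : << monalg.mcoeff m f *g m >> =
    monalg.mcoeff m f *: << m >> :> psymfun {poly rat}.
  by rewrite malgZU mulr1.
rewrite eZ; have -> : phi (monalg.mcoeff m f *: << m >>) =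
    mpolyC n (monalg.mcoeff m f) * phi << m >> by exact: psum_evalZ.
by rewrite mpoly.mcoeffCM rmorphM em f0 mul0r.
Qed.

End Nonvanishing.

(** * Energy and nonvanishing of Jack states *)

Section JackStateEigenvector.
Variable C : numClosedFieldType.
Local Notation fock := {malg C[{cmonom (bool * nat)%type}]}.
Variables (P b : C).
Hypothesis b0 : b != 0.
Variable J : seq nat -> psymfun {poly rat}.
Hypothesis jackJ : jack_family J.

(** At alpha = -1/b^2 a part [y] of zero-based index [i] contributes
    [y (y - 1) / b + 2 i y b + (b + 1/b) y], that is, [y^2 / b + (2 i + 1) y b]. *)
Lemma energy1E n Y : partition_of n Y ->
  - b * specialize b (jack_eigenvalue 'X (part_mnm n Y)) + Qb b * n%:R = energy1 b Y.
Proof.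
move=> pY; have /andP[p /eqP sY] := pY.
have szY : (size Y <= n)%N by rewrite -sY is_partition_size.
have -> : energy1 b Y = \sum_(i < n)
    ((nth 0 Y i)%:R ^+ 2 * b^-1 + (2 * i.+1 - 1)%:R * (nth 0 Y i)%:R * b).
  rewrite /energy1 (big_ord_widen_cond n xpredT (fun i : nat =>
    (nth 0 Y i)%:R ^+ 2 * b^-1 + (2 * i.+1 - 1)%:R * (nth 0 Y i)%:R * b)) //.
  rewrite big_mkcond; apply: eq_bigr => i _; case: ltnP => //= Yi.
  by rewrite nth_default // expr0n mul0r mulr0 mul0r addr0.
have -> : n%:R = \sum_(i < n) (nth 0 Y i)%:R :> C.
  by rewrite -natr_sum -sumn_nth take_oversize // sY.
rewrite /jack_eigenvalue (sum_minn_part pY) rmorphB rmorphM !rmorph_nat /=.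
rewrite [specialize b 'X]/specialize map_polyX hornerX.
rewrite natrM !natr_sum !mulr_sumr -sumrB mulr_sumr -big_split.
apply: eq_bigr => i _ /=; rewrite mpoly.mnmE; move: (nth 0%N Y i) => y.
have -> : (2 * i.+1 - 1)%:R = 2 * i%:R + 1 :> C.
  have -> : (2 * i.+1 - 1 = 2 * i + 1)%N by lia.
  by rewrite natrD natrM.
have -> : (y * y.-1)%:R = y%:R * (y%:R - 1) :> C.
  case: y => [|y]; rewrite ?mul0r // natrM; congr (_ * _).
  by rewrite -[in RHS]addn1 natrD addrK.
by rewrite /Qb natrM; field.
Qed.

Lemma Hsign_jack_eigen s h n Y : (forall k, pderiv (s, k) h = 0) ->
  partition_of n Y ->
  Hsign P b s (jack_factor b s h (J Y)) =
  (energy1 b Y - 2 * 'i * zero_mode P s * n%:R - 'i / 3 * zero_mode P s ^+ 3)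
    *: jack_factor b s h (J Y).
Proof.
move=> hh pY; have hJ := psum_homog_jack jackJ pY.
have [N0 hN0] := bounded_exists (jack_factor b s h (J Y)).
pose N := (N0 + n)%N; have nN : (n <= N)%N by exact: leq_addl.
rewrite (Hsign_jack_factor P b0 hh hJ nN (boundedW (leq_addr n N0) hN0)).
rewrite (jack_eigenfunction jackJ nN pY) -(energy1E pY).
apply: etrans (congr1 (fun u => - b *: u + _) (jack_factorZ _ _ _ _ _)) _.
apply: etrans (congr1 (fun u => u + _) (scalerA _ _ _)) _.
apply: etrans (esym (scalerDl _ _ _)) _.
apply: (congr1 (fun c : C => c *: jack_factor b s h (J Y))).
by rewrite !addrA.
Qed.

Lemma specialize_jack_neq0 n Y : partition_of n Y ->
  specialize b (mcoeff (monom_pow 0%N n mone) (J Y)) != 0.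
Proof.
move=> pY; apply: (@specialized_coeff_neq0 n C (specialize b)).
  exact: (psum_homog_jack jackJ).
move: pY => /andP[pY /eqP sY]; have := jack_normalized jackJ pY; rewrite sY => ->.
by rewrite rmorph_nat pnatr_eq0 eqn0Ngt fact_gt0.
Qed.

(** Differentiating [n] times in the first mode leaves [h] times the coefficient of [p_1 ^ n], up to
    nonzero scalars. *)
Lemma jack_factor_eq0 s h n Y : (forall k, pderiv (s, k) h = 0) ->
  partition_of n Y -> jack_factor b s h (J Y) = 0 -> h = 0.
Proof.
move=> hh pY e; have hJ := psum_homog_jack jackJ pY.
have := iter_pderiv_jack_factor b hh n (J Y).
have -> : iter n (pderiv (s, 0)) (jack_factor b s h (J Y)) = 0.
  rewrite e; elim: n {pY hJ} => // n IH; rewrite iterS IH; exact: pderiv0.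
have [k ek] := mcoeff_iter_pderiv 0%N n (J Y) mone.
have := psum_homog0 (psum_homog_iter_pderiv hJ); rewrite ek => ->.
set c := specialize b (mcoeff (monom_pow 0%N n mone) (J Y) *+ k.+1).
have c0 : c != 0.
  rewrite /c rmorphMn /= -mulr_natr mulf_neq0 ?pnatr_eq0 //.
  exact: specialize_jack_neq0.
have -> : jack_factor b s h (mcoeff (monom_pow 0%N n mone) (J Y) *+ k.+1)%:MP = c *: h.
  apply: etrans (congr1 ( *%R^~ h) (jack_state_morphismC b s _)) _.
  exact: mul_malgC.
move=> e1; have : ((- ('i * b))^-1 ^+ n * c) *: h = 0.
  by apply: etrans (esym (scalerA _ _ _)) _; exact: esym e1.
move=> e2; apply/malgP => m; rewrite mcoeff0.
have := congr1 (mcoeff m) e2; rewrite mcoeff0 => e3.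
have : (- ('i * b))^-1 ^+ n * c * mcoeff m h = 0 := etrans (esym (mcoeffZ _ _ _)) e3.
move/eqP; rewrite mulf_eq0 mulf_eq0 (negbTE c0) orbF expf_eq0 invr_eq0.
by rewrite (negbTE (opp_Ci_mul_neq0 b0)) andbF => /eqP.
Qed.

Variables Y1 Y2 : seq nat.
Hypothesis p1 : is_partition Y1.
Hypothesis p2 : is_partition Y2.

Local Notation v := (jack_state b (J Y1) (J Y2)).
Local Notation phi := (jack_state_morphism b).

Lemma jack_state_true : v = jack_factor b true (phi false (J Y2)) (J Y1).
Proof. by rewrite /jack_state /jack_factor; congr (_ * _); exact: mulr1. Qed.

Lemma jack_state_false : v = jack_factor b false (phi true (J Y1)) (J Y2).
Proof. rewrite jack_state_true; exact: mulrC. Qed.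

Lemma pderiv_jack_state_other s k f : pderiv (s, k) (phi (~~ s) f) = 0.
Proof. by rewrite pderiv_jack_state; case: s. Qed.

Lemma partition_of_sumn Y : is_partition Y -> partition_of (sumn Y) Y.
Proof. by move=> p; rewrite /partition_of p eqxx. Qed.

(** The cubes of the opposite zero modes cancel, and ['i * 'i = -1] turns the terms linear in the
    zero mode into [2 P |Y1|] and [- 2 P |Y2|]. *)
Lemma jack_state_eigen : H0 P b v = energy P b Y1 Y2 *: v.
Proof.
have e1 : Hsign P b true v = (energy1 b Y1 - 2 * 'i * ('i * P) * (sumn Y1)%:R
    - 'i / 3 * ('i * P) ^+ 3) *: v.
  rewrite jack_state_true; apply: Hsign_jack_eigen (partition_of_sumn p1) => k.
  exact: (pderiv_jack_state_other true).
have e2 : Hsign P b false v = (energy1 b Y2 - 2 * 'i * (- ('i * P)) * (sumn Y2)%:R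
    - 'i / 3 * (- ('i * P)) ^+ 3) *: v.
  rewrite jack_state_false; apply: Hsign_jack_eigen (partition_of_sumn p2) => k.
  exact: (pderiv_jack_state_other false).
apply: etrans (f_equal2 +%R e1 e2) _; apply: etrans (esym (scalerDl _ _ _)) _.
apply: (congr1 (fun c : C => c *: v)); rewrite /energy.
have i2 : 'i * 'i = -1 :> C by rewrite -expr2 sqrCi.
have -> : 2 * 'i * ('i * P) * (sumn Y1)%:R = - (2 * P * (sumn Y1)%:R).
  by rewrite -!mulrA [in LHS](mulrA 'i) i2; ring.
have -> : 2 * 'i * (- ('i * P)) * (sumn Y2)%:R = 2 * P * (sumn Y2)%:R.
  by rewrite !mulrN -!mulrA [in LHS](mulrA 'i) i2; ring.
by ring.
Qed.

Lemma jack_state_neq0 : v != 0.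
Proof.
(* The two factors are stripped in turn: sign [+] with [h] the other Jack state, then sign [-] with
   [h = 1]. *)
apply/eqP; rewrite jack_state_true => /(jack_factor_eq0 _ (partition_of_sumn p1)) e.
have e2 : phi false (J Y2) = 0.
  by apply: e => k; exact: (pderiv_jack_state_other true).
have : jack_factor b false 1 (J Y2) = 0 by apply: etrans (mulr1 _) _.
move=> /(jack_factor_eq0 _ (partition_of_sumn p2)) one0.
have : (1 : fock) = 0 by apply: one0 => k; exact: pderivC.
by move/eqP; rewrite oner_eq0.
Qed.

End JackStateEigenvector.

(** * The perturbation series *)

Section FiniteDimension.
Variables (I : choiceType) (K : fieldType).
Local Notation V := {malg K[{cmonom I}]}.
Implicit Types (u w : V).

Lemma supported_coord (ms : seq {cmonom I}) u :
  uniq ms -> supported (fun m => m \in ms) u ->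
  u = \sum_(m <- ms) u@_m *: << m >>.
Proof.
move=> ums /supportedP hu; apply/malgP => m; rewrite raddf_sum /=.
have cE m' : (u@_m' *: << m' >>)@_m = if m' == m then u@_m else 0.
  apply: etrans (mcoeffZ _ _ _) _; rewrite mcoeffU.
  by case: eqP => [->|_]; rewrite ?mulr1n ?mulr1 // mulr0n mulr0.
rewrite (eq_bigr _ (fun m' _ => cE m')) -big_mkcond /=.
have [mms|mms] := boolP (m \in ms).
  by rewrite -big_filter filter_pred1_uniq // big_seq1.
rewrite big1_seq => [|m' /andP[/eqP -> mms']]; last by rewrite mms' in mms.
by apply/eqP; apply: contraNT mms => /hu.
Qed.

(** In coordinates on [ms], injectivity makes the matrix of [T] row-free, hence invertible. *)
Lemma injective_surjective (ms : seq {cmonom I}) (T : V -> V) : is_linear T ->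
  (forall u, supported (fun m => m \in ms) u -> supported (fun m => m \in ms) (T u)) ->
  (forall u, supported (fun m => m \in ms) u -> T u = 0 -> u = 0) ->
  forall w, supported (fun m => m \in ms) w ->
  exists2 u, supported (fun m => m \in ms) u & T u = w.
Proof.
move=> lT; wlog ums : ms / uniq ms => [IH pT iT w hw|pT iT w hw].
  have e u : supported (fun m => m \in ms) u <-> supported (fun m => m \in undup ms) u.
    by split; apply: supportedW => m; rewrite mem_undup.
  have [u hu Tu] := IH (undup ms) (undup_uniq _)
    (fun u h => (e _).1 (pT u ((e u).2 h))) (fun u h => iT u ((e u).2 h))
    w ((e w).1 hw).
  by exists u => //; apply/e.
pose N := size ms; pose mon (i : 'I_N) := nth mone ms i.
pose vec (r : 'rV[K]_N) : V := \sum_i r 0 i *: << mon i >>.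
pose crd u : 'rV[K]_N := \row_i u@_(mon i).
have mon_inj i j : (mon i == mon j) = (i == j) by rewrite nth_uniq.
have mon_ms i : mon i \in ms by rewrite mem_nth.
have vecP r : supported (fun m => m \in ms) (vec r).
  apply: supported_sum => i _; apply: supportedZ => m /(fsubsetP msuppU_le).
  by rewrite inE => /eqP ->.
have vecK r : crd (vec r) = r.
  apply/rowP => j; rewrite mxE raddf_sum (bigD1 j) //= [X in _ + X]big1 => [|i ij].
    rewrite addr0; apply: etrans (mcoeffZ _ _ _) _.
    by rewrite mcoeffUU mulr1.
  apply: etrans (mcoeffZ _ _ _) _.
  by rewrite mcoeffU mon_inj (negbTE ij) mulr0n mulr0.
have crdK u : supported (fun m => m \in ms) u -> vec (crd u) = u.
  move=> hu; rewrite [RHS](supported_coord ums hu) (big_nth mone) big_mkord.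
  by apply: eq_bigr => i _; rewrite mxE.
pose A : 'M[K]_N := \matrix_(i, j) (T << mon i >>)@_(mon j).
have TA r : crd (T (vec r)) = r *m A.
  apply/rowP => j; rewrite !mxE (is_linear_sum_apply lT) raddf_sum.
  apply: eq_bigr => i _ /=; rewrite (is_linearZ_apply lT) !mxE; exact: mcoeffZ.
have unitA : A \in unitmx.
  rewrite -row_free_unit; apply: inj_row_free => r rA; rewrite -[r]vecK.
  have -> : vec r = 0.
    apply: iT => //; rewrite -[T _]crdK; last exact: pT.
    rewrite TA rA /vec big1 // => i _; rewrite mxE; exact: scale0r.
  by apply/rowP => i; rewrite !mxE mcoeff0.
exists (vec (crd w *m invmx A)) => //.
rewrite -[LHS]crdK; last exact: pT.
by rewrite TA mulmxKV // crdK.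
Qed.

Lemma supported_split (Q : {cmonom I} -> Prop) u : exists u1 u2,
  [/\ u = u1 + u2, supported Q u1 & supported (fun m => ~ Q m) u2].
Proof.
exists (\sum_(m <- msupp u | `[< Q m >]) << u@_m *g m >>).
exists (\sum_(m <- msupp u | ~~ `[< Q m >]) << u@_m *g m >>).
split; first by rewrite [LHS]monalgE (bigID (fun m => `[< Q m >])).
  apply: supported_sum => m /asboolP Qm m' /(fsubsetP msuppU_le).
  by rewrite inE => /eqP ->.
apply: supported_sum => m /asboolP Qm m' /(fsubsetP msuppU_le).
by rewrite inE => /eqP ->.
Qed.

Lemma supported_disjoint (Q : {cmonom I} -> Prop) u :
  supported Q u -> supported (fun m => ~ Q m) u -> u = 0.
Proof.
move=> /supportedP h1 /supportedP h2; apply/malgP => m; rewrite mcoeff0.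
by apply/eqP/negPn/negP => nz; exact: h2 nz (h1 _ nz).
Qed.

End FiniteDimension.

Lemma degree1 s : degree s (mone : {cmonom (bool * nat)%type}) = 0%N.
Proof. by rewrite /degree big_mkcond mdom1 big_seq_fset0. Qed.

(** A monomial other than 1 is a variable, whose index is less than the degree, times a monomial of
    smaller degree. *)
Lemma finite_degree d : exists ms : seq {cmonom (bool * nat)%type},
  forall m, (degree true m + degree false m <= d)%N -> m \in ms.
Proof.
have deg_gt (m : {cmonom (bool * nat)%type}) x :
    (0 < m x)%N -> (x.2 < degree true m + degree false m)%N.
  move=> mx; rewrite -(mulcm_divcm mx) !degreeM; case: x {mx} => [[] k];
    by rewrite !degreeU /=; lia.
elim: d => [|d [ms IH]].
  exists [:: mone] => m; rewrite leqn0 inE => /eqP m0.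
  apply/cmP => x; rewrite cm1; apply/eqP; rewrite -leqn0 leqNgt.
  by apply/negP => /deg_gt; rewrite m0.
have [xs xsP] : exists xs : seq (bool * nat), forall x, (x.2 < d.+1)%N -> x \in xs.
  exists [seq (s, k) | s <- [:: true; false], k <- iota 0 d.+1] => -[s k] kd.
  by apply/allpairsP; exists (s, k); split; [case: (s)|rewrite mem_iota|].
exists (ms ++ [seq m *c ucm x | m <- ms, x <- xs]).
move=> m md; rewrite mem_cat.
have [->|m1] := eqVneq m mone.
  by apply/orP; left; apply: IH; rewrite !degree1.
have [x mx] : exists x, (0 < m x)%N.
  apply/not_existsP => h; case/eqP: m1; apply/eqP/cmP => x; rewrite cm1.
  by apply/eqP; rewrite -leqn0 leqNgt; apply/negP/h.
have xd := deg_gt _ _ mx.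
apply/orP; right; apply/allpairsP; exists (divcm m (ucm x), x); split => /=.
- apply: IH; move: md; rewrite -{1 2}(mulcm_divcm mx) !degreeM.
  by case: x {mx xd} => [[] k]; rewrite !degreeU /=; lia.
- by apply: xsP; exact: leq_trans xd md.
- by rewrite mulcm_divcm.
Qed.

(** For the telescoping: [y i] will be the image under [T] of the [i]-th term of the series, and
    [z i] its image under [HI]. *)
Lemma sum_shift (V : zmodType) (n : nat) (y z : nat -> V) :
  y 0%N = 0 -> z n = 0 -> (forall i, y i.+1 = z i) ->
  \sum_(i < n.+1) y i = \sum_(i < n.+1) z i.
Proof.
move=> y0 zn yz; rewrite big_ord_recl [RHS]big_ord_recr /= y0 zn add0r addr0.
by apply: eq_bigr => i _; rewrite -yz.
Qed.

(** * The resolvent and the telescoping series *)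

Section Perturbation.
Variable C : numClosedFieldType.
Local Notation fock := {malg C[{cmonom (bool * nat)%type}]}.
Variables (P b : C) (Y1 Y2 : seq nat).
Hypothesis gen : generic P b Y1 Y2.
Implicit Types (u w : fock).

Local Notation E := (energy P b Y1 Y2).
Local Notation n1 := (sumn Y1).
Local Notation n2 := (sumn Y2).
Local Notation T := (fun u : fock => E *: u - H0 P b u).

(** A filtration by the degree of sign [+]: level 0 contains the Jack state, level 1 is
    [upper_space], [HI] raises the level, and beyond level [n2] only 0 remains. *)
Definition level (j p q : nat) : Prop := (n1 + j <= p)%N /\ (p + q = n1 + n2)%N.

Lemma is_linear_T : @is_linear C fock T.
Proof.
apply: is_linearB; last exact: is_linear_H0.
exact: (is_linearZ E (@is_linear_id _ _)).
Qed.

Lemma graded_T D u : graded D u -> graded D (T u).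
Proof. by move=> h; apply: supportedB; [exact: supportedZ|exact: graded_H0]. Qed.

Lemma levelW j p q : (0 < j)%N -> level j p q -> level 1 p q.
Proof. by move=> j0 [h1 h2]; split=> //; lia. Qed.

(** [generic] speaks of one component at a time. The part of [u] in one bidegree and the rest of [u]
    have images with disjoint supports; as these add up to 0, each vanishes. *)
Lemma T_injective u : graded (level 1) u -> T u = 0 -> u = 0.
Proof.
move=> hu Tu0; apply/eqP/negPn/negP; rewrite -msupp_eq0 => /fset0Pn[m mu].
have [lm em] := hu m mu.
pose D p q := p = degree true m /\ q = degree false m.
have [u1 [u2 [eu h1 h2]]] :=
  supported_split (fun m' => D (degree true m') (degree false m')) u.
have e12 : T u1 + T u2 = 0 by rewrite -(is_linear_add is_linear_T) -eu.
have T1 : T u1 = 0.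
  apply: (supported_disjoint (Q := fun m' => D (degree true m') (degree false m'))).
    exact: (graded_T (D := D)).
  have -> : T u1 = (-1) *: T u2.
    by rewrite scaleN1r; apply/eqP; rewrite -addr_eq0; apply/eqP.
  apply: supportedZ; exact: (graded_T (D := fun p q => ~ D p q)).
case: (gen em); first by rewrite addn1 in lm.
exists u1; first exact: h1.
split; last by apply/esym/eqP; rewrite -subr_eq0; apply/eqP.
apply: contraTneq mu => u10; rewrite -mcoeff_eq0 eu u10 add0r.
by rewrite mcoeff_eq0; apply/negP => /h2; apply.
Qed.

(** Stated at every level, so that solving for [u] does not undo the raising by [HI]. *)
Lemma T_surjective j w : (0 < j)%N -> graded (level j) w ->
  exists2 u, graded (level j) u & T u = w.
Proof.
move=> j0 hw; have [ms0 hms] := finite_degree (n1 + n2).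
pose ms := [seq m <- ms0 | `[< level j (degree true m) (degree false m) >]].
have msP u : supported (fun m => m \in ms) u <-> graded (level j) u.
  split; apply: supportedW => m.
    by rewrite mem_filter => /andP[/asboolP].
  move=> h; rewrite mem_filter; apply/andP; split; first exact/asboolP.
  by apply: hms; case: h => _ ->.
have [u /msP] := @injective_surjective _ C ms T is_linear_T
  (fun u h => (msP _).2 (graded_T ((msP _).1 h)))
  (fun u h => T_injective (supportedW (fun m => @levelW j _ _ j0) ((msP u).1 h)))
  w ((msP _).2 hw).
by exists u.
Qed.

(** [resolvent] chooses some solution in [upper_space]; injectivity identifies it with the one that
    [T_surjective] finds in level [j]. *)
Lemma resolventP j w : (0 < j)%N -> graded (level j) w ->
  let u := resolvent P b (upper_space Y1 Y2) E w in graded (level j) u /\ T u = w.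
Proof.
move=> j0 hw u; have [u' hu' eu'] := T_surjective j0 hw.
have up x : graded (level 1) x <-> upper_space Y1 Y2 x.
  by split; apply: supportedW => m; rewrite /level addn1.
have hu1 : graded (level 1) u' by apply: supportedW hu' => m; exact: levelW.
have [hu eu] : upper_space Y1 Y2 u /\ T u = w.
  have ex : exists x, upper_space Y1 Y2 x /\ T x = w.
    by exists u'; split; first exact/up.
  exact: (@xgetPex _ (0 : fock) (fun x => upper_space Y1 Y2 x /\ T x = w) ex).
suff -> : u = u' by [].
apply/eqP; rewrite -subr_eq0; apply/eqP/T_injective.
  by apply: supportedB => //; apply/up.
have -> : u - u' = (-1) *: u' + u by rewrite scaleN1r addrC.
apply: etrans (is_linear_T (-1) u' u) _.
apply: etrans (f_equal2 (fun x y => (-1) *: x + y) eu' eu) _.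
by rewrite scaleN1r addNr.
Qed.

Lemma graded_HI_level j u : graded (level j) u -> graded (level j.+1) (HI P b u).
Proof.
move=> hu; apply: supportedW (@graded_HI _ P b _ _ hu) => m [k [kp [h1 h2]]].
by rewrite /level; lia.
Qed.

Lemma perturbed_eigenvector v :
  graded (fun p q => p = n1 /\ q = n2) v -> v != 0 -> H0 P b v = E *: v ->
  eigenvector (H P b) E (perturbed P b Y1 Y2 v).
Proof.
move=> hv v0 ev.
pose S u := resolvent P b (upper_space Y1 Y2) E (HI P b u).
pose x n := iter n S v.
have xP n : graded (level n) (x n).
  elim: n => [|n IH].
    by apply: supportedW hv => m [-> ->]; rewrite /level addn0.
  by have [] := resolventP (ltn0Sn n) (graded_HI_level IH).
have Tx n : T (x n.+1) = HI P b (x n).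
  by have [] := resolventP (ltn0Sn n) (graded_HI_level (xP n)).
have x0 n : (n2 < n)%N -> x n = 0.
  move=> n2n; apply/eqP; rewrite -msupp_eq0; apply/eqP/fsetP => m; rewrite inE.
  by apply/negP => /(xP n)[]; lia.
have -> : perturbed P b Y1 Y2 v = \sum_(n <- iota 0 n2.+1) x n.
  apply: fsum_seq => //; first exact: iota_uniq.
  move=> n _; rewrite mem_iota add0n /= => nn; apply: x0.
  by move: nn; rewrite -leqNgt.
rewrite -[n2.+1]subn0 -/(index_iota 0 n2.+1) big_mkord.
set R := \sum_(n < n2.+1) x n; split.
  (* A monomial of [v] has degree [n1] of sign [+], lower than in any later term, so its coefficient
     in [R] is that in [v]. *)
  have [m mv] : exists m, m \in msupp v by apply/fset0Pn; rewrite msupp_eq0.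
  have [dm _] := hv m mv; apply: contraTneq mv => R0; rewrite -mcoeff_eq0.
  have := congr1 (mcoeff m) R0; rewrite mcoeff0 raddf_sum big_ord_recl /= big1.
    by rewrite addr0 => ->.
  move=> i _; apply: mcoeff_outdom; apply/negP => /(xP (bump 0 i))[].
  by rewrite dm /bump; lia.
have TR : T R = HI P b R.
  have Tx0 : T (x 0%N) = 0 by apply/eqP; rewrite subr_eq0; apply/eqP; exact: esym ev.
  (* This is [T] of the next term, which is zero. *)
  have HIx : HI P b (x n2) = 0.
    apply: etrans (esym (Tx n2)) _.
    exact: etrans (congr1 T (x0 _ (ltnSn _))) (is_linear0 is_linear_T).
  apply: etrans (is_linear_sum_apply is_linear_T _ _) _.
  apply: etrans _ (esym (is_linear_sum_apply (@is_linear_HI _ P b) _ _)).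
  exact: (sum_shift (y := fun n => T (x n)) (z := fun n => HI P b (x n))).
have -> : H P b R = H0 P b R + T R by rewrite TR.
by rewrite addrC; exact: subrK.
Qed.

End Perturbation.

(** * Bidegree of Jack states *)

Section JackGrading.
Variable C : numClosedFieldType.
Local Notation fock := {malg C[{cmonom (bool * nat)%type}]}.
Variable b : C.

Lemma supported_jack_state_morphism s n (f : psymfun {poly rat}) :
  psum_homog n f ->
  supported (fun m => degree s m = n /\ degree (~~ s) m = 0%N)
    (jack_state_morphism b s f).
Proof.
move=> hf; pose phi := jack_state_morphism b s.
apply: (malg_ind_supp (Q := fun f => supported _ (phi f))) => [|g h hg hh|m mf].
- by rewrite /phi raddf0; exact: supported0.
- have -> : phi (g + h) = phi g + phi h := raddfD (jack_state_morphism b s) g h.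
  exact: supportedD hg hh.
rewrite -(hf m mf); move: (f@_m) => c {mf}.
elim/(@cmonom_ind nat): m => [|k m IH].
  rewrite [phi _]jack_state_morphismC => m /(fsubsetP msuppU_le).
  rewrite inE => /eqP ->; rewrite !degree1.
  by rewrite /psum_weight mdom1 big_seq_fset0.
have -> : phi << c *g m *c ucm k >> =
    phi << c *g m >> * ((- ('i * b))^-1 *: creation C s k).
  apply: etrans (congr1 phi (_ : _ = << c *g m >> * << ucm k >>)) _.
    by rewrite mul_monom mulr1.
  apply: etrans (rmorphM (jack_state_morphism b s) _ _) _.
  congr (_ * _); exact: jack_state_morphismU.
have hu : supported (eq (ucm (s, k))) ((- ('i * b))^-1 *: creation C s k).
  by apply: supportedZ; exact: supported_ucm.
apply: (supportedM IH hu).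
move=> m1 _ [e1 e2] <-; rewrite !degreeM !degreeU psum_weightM psum_weightU eqxx e1 e2.
by split=> //; case: (s).
Qed.

Lemma graded_jack_state n1 n2 (f1 f2 : psymfun {poly rat}) :
  psum_homog n1 f1 -> psum_homog n2 f2 ->
  graded (fun p q => p = n1 /\ q = n2) (jack_state b f1 f2).
Proof.
move=> /(supported_jack_state_morphism (s := true)) h1.
move=> /(supported_jack_state_morphism (s := false)) h2.
have -> : jack_state b f1 f2 =
    jack_state_morphism b true f1 * jack_state_morphism b false f2.
  by rewrite /jack_state; congr (_ * _); exact: mulr1.
apply: (supportedM h1 h2) => m1 m2 [/= e1 e2] [/= e3 e4].
by rewrite !degreeM e1 e2 e3 e4 addn0.
Qed.

End JackGrading.

Theorem proposition2 (R : realType) (b P : R[i]) (Y1 Y2 : seq nat)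
    (J : seq nat -> psymfun {poly rat}) :
  b != 0 -> is_partition Y1 -> is_partition Y2 -> jack_family J ->
  generic P b Y1 Y2 ->
  eigenvector (H P b) (energy P b Y1 Y2)
    (perturbed P b Y1 Y2 (jack_state b (J Y1) (J Y2))).
Proof.
move=> b0 p1 p2 jackJ gen; apply: perturbed_eigenvector => //.
- apply: graded_jack_state; apply: (psum_homog_jack jackJ);
  exact: partition_of_sumn.
- exact: jack_state_neq0.
- exact: jack_state_eigen.
Qed.
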